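(* Let $n\ge1$, $Q=n+2\ge3$, let $k\ge1$ be an integer and $\beta\in\mathbb{R}$. Then for every $u\in C_0^\infty(\mathbb{R}^{n+1}\setminus\{o\})$: (i) If $k=2l$ with $l\ge1$, then $$\int_{\mathbb{R}^{n+1}}\frac{|\mathcal{L}_{\varrho,G}^{\,l}u|^2}{|\nabla_G\varrho|^{2(2l-1)}\varrho^{\beta}}\,dx\,dt=C_{k,2,\beta}\int_{\mathbb{R}^{n+1}}\frac{|u|^2|\nabla_G\varrho|^2}{\varrho^{\beta+4l}}\,dx\,dt+\sum_{j=0}^{2l-1}D_{j,l,\beta}\int_{\mathbb{R}^{n+1}}\frac{|\mathcal{R}_{\beta+2j,\,2l-1-j}(u)|^2}{|\nabla_G\varrho|^{2(2l-1-j)}\varrho^{\beta+2j}}\,dx\,dt,$$ where the constants $D_{j,m,\beta}$ are given by the iterative formula $$D_{j,m+1,\beta}=\Lambda_{2m+2}(Q,2,\beta)\,D_{j-2,m,\beta}+A_{\beta+4m}\,D_{j-1,m,\beta}+D_{j,m,\beta},\qquad 0\le j\le 2m+2,\ m\ge0,$$ with the convention that $D_{0,0,\beta}=1$ for every $\beta$ and $D_{j,m,\beta}=0$ for $j<0$ or $j>2m$. (ii) If $k=2l+1$ with $l\ge0$, then $$\int_{\mathbb{R}^{n+1}}\frac{|\nabla_{\varrho,G}\mathcal{L}_{\varrho,G}^{\,l}u|^2}{|\nabla_G\varrho|^{4l}\varrho^{\beta}}\,dx\,dt=C_{k,2,\beta}\int_{\mathbb{R}^{n+1}}\frac{|u|^2|\nabla_G\varrho|^2}{\varrho^{2(2l+1)+\beta}}\,dx\,dt+\sum_{j=0}^{2l}\widetilde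 D_{j,l,\beta}\int_{\mathbb{R}^{n+1}}\frac{|\mathcal{R}_{\beta+2j,\,2l-j}(u)|^2}{|\nabla_G\varrho|^{2(2l-j)}\varrho^{\beta+2j}}\,dx\,dt,$$ where $\widetilde D_{j,l,\beta}=B_{j,l,\beta,0}+\frac{(Q-\beta-2)^2}{4}D_{j-1,l,\beta+2}$ for $0\le j\le 2l$, the $D$'s are as in (i), and the constants $B_{j,m,\beta,k'}$ ($k'\ge0$ an integer) are given by $$B_{j,m+1,\beta,k'}=\Lambda_2(Q,2,\beta+2k'+2)\,B_{j-2,m,\beta+4,k'}+A_{\beta+2k'+2}\,B_{j-1,m,\beta+2,k'+1}+B_{j,m,\beta,k'+2},\qquad 0\le j\le 2m+2,$$ with $B_{0,0,\beta,k'}=1$ for every $\beta,k'$, and $B_{j,m,\beta,k'}=0$ if $j<0$ or $j>2m$.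
   Context: Grushin space $G=\mathbb{R}^{n+1}$: points $(x,t)$ with $x\in\mathbb{R}^n$, $t\in\mathbb{R}$; origin $o=(\vec 0,0)$; homogeneous dimension $Q=n+2$; homogeneous norm $\varrho(x,t)=(|x|^4+4t^2)^{1/4}$; Grushin gradient $\nabla_G=(\nabla_x,|x|\partial_t)$, so that $|\nabla_G\varrho|^2=|x|^2/\varrho^2=:\psi$ away from $o$. Polar coordinates $(\varrho,\phi,w)$: $x=\varrho\sin^{1/2}\!\phi\;w$, $w\in\mathbb{S}^{n-1}$, $t=\frac{\varrho^2}{2}\cos\phi$, $0<\phi<\pi$. $\partial_\varrho$ is the partial derivative in $\varrho$ in these coordinates, i.e. $\partial_\varrho u=\frac1\varrho(x\cdot\nabla_xu+2t\,\partial_tu)$. Radial operators: $\nabla_{\varrho,G}u=\psi^{1/2}(\partial_\varrho u,0,0)$, so $|\nabla_{\varrho,G}u|=\psi^{1/2}|\partial_\varrho u|$, and $\mathcal{L}_{\varrho,G}u=\psi\big(\partial_\varrho^2u+\frac{Q-1}{\varrho}\partial_\varrho u\big)$; $\mathcal{L}_{\varrho,G}^{\,l}$ is the $l$-fold iterate ($\mathcal{L}^{\,0}_{\varrho,G}u=u$). $C_0^\infty$ denotes smooth compactly supported real-valued functions. First-order operators: for $\beta\in\mathbb{R}$, $T_\beta(u)=|\nabla_G\varrho|\big(\partial_\varrho u+\frac{Q-\beta-2}{2\varrho}u\big)$; for integers $k\ge0$, $\mathcal{R}_{\beta,k}(u)=T_\beta\circ T_{\beta+2}\circ\cdots\circ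 T_{\beta+2k}(u)$. Constants (with $p=2$): $\Lambda_1(Q,2,\beta)=\big(\frac{Q-2-\beta}{2}\big)^2$; for integers $i\ge2$, $\Lambda_i(Q,2,\beta)=\Big(\frac{(Q+\beta+2(i-2))(Q-\beta-2i)}{4}\Big)^2$; $C_{2l,2,\beta}=\prod_{i=1}^{l}\Lambda_{2i}(Q,2,\beta)$; $C_{2l+1,2,\beta}=\prod_{i=0}^{l}\Lambda_{2i+1}(Q,2,\beta)$; and for $\mu\in\mathbb{R}$, $A_\mu=\frac{(Q+\mu)^2+(Q-4-\mu)^2}{4}$. *)

(* Defs.v *)
From HB Require Import structures.
From mathcomp Require Import all_boot all_order all_algebra.
From mathcomp Require Import all_classical all_reals all_analysis.
Set Implicit Arguments.
Unset Strict Implicit.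
Unset Printing Implicit Defensive.
Import Order.TTheory GRing.Theory Num.Theory.
Import numFieldNormedType.Exports.

Local Open Scope classical_set_scope.
Local Open Scope ring_scope.

(* 'rV[R]_n carries the sigma-algebra generated by the coordinates, i.e. the
   Borel sigma-algebra of R^n. *)
Definition measure_rV_display : measure_display.
Proof. exact: default_measure_display. Qed.

Section measurable_rV.
Context {R : realType} {n : nat}.

Let coord_rV (i : 'I_n) (x : 'rV[R]_n) : measurableTypeR R := x ord0 i.

Let rV_set0 : g_sigma_preimage coord_rV set0.
Proof. exact: sigma_algebra0. Qed.

Let rV_setC A : g_sigma_preimage coord_rV A -> g_sigma_preimage coord_rV (~` A).
Proof. exact: sigma_algebraC. Qed.

Let rV_bigcup (F : (set 'rV[R]_n)^nat) :
  (forall i, g_sigma_preimage coord_rV (F i)) ->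
  g_sigma_preimage coord_rV (\bigcup_i (F i)).
Proof. exact: sigma_algebra_bigcup. Qed.

HB.instance Definition _ := @isMeasurable.Build measure_rV_display
  'rV[R]_n (g_sigma_preimage coord_rV) rV_set0 rV_setC rV_bigcup.

Lemma measurable_coord_rV (i : 'I_n) :
  measurable_fun [set: 'rV[R]_n]
    ((fun x => x ord0 i) : 'rV[R]_n -> measurableTypeR R).
Proof.
move=> _ Y mY; rewrite setTI; apply: sub_sigma_algebra => /=.
rewrite -bigcup_seq/=; exists i => /=; first by rewrite mem_index_enum.
by exists Y => //; rewrite setTI.
Qed.

Lemma measurable_fun_rV d (T : measurableType d) (f : T -> 'rV[R]_n) :
  (forall i, measurable_fun [set: T]
     ((fun x => f x ord0 i) : T -> measurableTypeR R)) ->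
  measurable_fun [set: T] f.
Proof.
move=> mf; rewrite /measurable_fun => _ Y mY; rewrite setTI.
move: Y mY; apply: smallest_sub.
  split; first by rewrite /= preimage_set0.
    by move=> A mA /=; rewrite setTD preimage_setC; exact: measurableC.
  by move=> F mF /=; rewrite preimage_bigcup; exact: bigcup_measurable.
move=> B; rewrite -bigcup_seq/= => -[i _ [Y mY <-]].
by rewrite setTI; have := mf i measurableT Y mY; rewrite setTI.
Qed.

Lemma measurable_box (I : 'I_n -> set (measurableTypeR R)) :
  (forall i, measurable (I i)) ->
  measurable [set x : 'rV[R]_n | forall i, I i (x ord0 i)].
Proof.
move=> mI; rewrite [X in measurable X](_ : _ =
    \big[setI/setT]_(i <- index_enum 'I_n) [set x : 'rV[R]_n | I i (x ord0 i)]).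
  apply: bigsetI_measurable => i _; rewrite -[X in measurable X]setTI.
  exact: (measurable_coord_rV i measurableT (mI _)).
rewrite -bigcap_seq predeqE => x; split=> /= [h i _|h i]; first exact: h.
by apply: h; rewrite /= mem_index_enum.
Qed.

End measurable_rV.

Section lebesgue_rV.
Context {R : realType}.

Definition cons_rV n (p : measurableTypeR R * 'rV[R]_n) : 'rV[R]_n.+1 :=
  \row_i oapp (fun j => p.2 ord0 j) p.1 (unlift ord0 i).

Definition uncons_rV n (x : 'rV[R]_n.+1) : measurableTypeR R * 'rV[R]_n :=
  (x ord0 ord0, \row_j x ord0 (lift ord0 j)).

Lemma uncons_rVK n : cancel (@uncons_rV n) (@cons_rV n).
Proof.
move=> x; apply/rowP => i; rewrite !mxE.
by case: unliftP => [j|] -> //=; rewrite mxE.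
Qed.

Lemma cons_rVK n : cancel (@cons_rV n) (@uncons_rV n).
Proof.
move=> [a x]; congr pair; first by rewrite mxE unlift_none.
by apply/rowP => j; rewrite !mxE liftK.
Qed.

Lemma measurable_cons_rV n : measurable_fun [set: _] (@cons_rV n).
Proof.
apply: measurable_fun_rV => i.
case: (unliftP ord0 i) => [j ->|->].
  rewrite (_ : (fun _ => _) = (fun x : 'rV[R]_n => x ord0 j) \o snd).
    apply: (measurableT_comp (measurable_coord_rV j)); exact: measurable_snd.
  by apply/funext => -[a x]; rewrite /= mxE liftK.
rewrite (_ : (fun _ => _) = fst); first exact: measurable_fst.
by apply/funext => -[a x]; rewrite /= mxE unlift_none.
Qed.

Lemma measurable_uncons_rV n : measurable_fun [set: _] (@uncons_rV n).
Proof.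
apply: measurable_fun_pair; first exact: measurable_coord_rV.
apply: measurable_fun_rV => i.
rewrite (_ : (fun _ => _) = (fun x : 'rV[R]_n.+1 => x ord0 (lift ord0 i))).
  exact: measurable_coord_rV.
by apply/funext => x; rewrite mxE.
Qed.

Section step.
Context (n : nat) (m : {sigma_finite_measure set 'rV[R]_n -> \bar R}).

Definition lebesgue_cons : set 'rV[R]_n.+1 -> \bar R :=
  pushforward (@lebesgue_measure R \x m)%E (@cons_rV n).

Let mcons A : measurable A -> measurable (@cons_rV n @^-1` A).
Proof. by move=> mA; rewrite -[X in measurable X]setTI; exact: measurable_cons_rV. Qed.

Let lebesgue_cons0 : lebesgue_cons set0 = 0%E.
Proof. by rewrite /lebesgue_cons /pushforward preimage_set0 measure0. Qed.

Let lebesgue_cons_ge0 A : (0 <= lebesgue_cons A)%E.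
Proof. by rewrite /lebesgue_cons /pushforward measure_ge0. Qed.

Let lebesgue_cons_sigma_additive : semi_sigma_additive lebesgue_cons.
Proof.
move=> F mF tF mUF; rewrite /lebesgue_cons /pushforward preimage_bigcup.
apply: measure_semi_sigma_additive.
- by move=> k; exact: mcons.
- apply/trivIsetP => i j _ _ ij; rewrite -preimage_setI.
  by move/trivIsetP : tF => /(_ _ _ I I ij) ->; rewrite preimage_set0.
- by rewrite -preimage_bigcup; exact: mcons.
Qed.

HB.instance Definition _ := isMeasure.Build _ _ _ lebesgue_cons
  lebesgue_cons0 lebesgue_cons_ge0 lebesgue_cons_sigma_additive.

Let lebesgue_cons_sigma_finite : sigma_finite setT lebesgue_cons.
Proof.
have /sigma_finiteP[F [TF ndF Foo]] := sigma_finiteT (@lebesgue_measure R).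
have /sigma_finiteP[G [TG ndG Goo]] := sigma_finiteT m.
exists (fun k => @uncons_rV n @^-1` (F k `*` G k)).
  rewrite -preimage_bigcup (_ : \bigcup_k _ = setT) ?preimage_setT//.
  rewrite -setXTT TF TG predeqE => -[x y]; split.
    by move=> [k _ []/= ? ?]; split; exists k.
  move=> [/= [k _ Fkx] [l _ Gly]]; exists (maxn k l) => //; split.
  - by move: x Fkx; exact/subsetPset/ndF/leq_maxl.
  - by move: y Gly; exact/subsetPset/ndG/leq_maxr.
move=> k; have [mF Fkoo] := Foo k; have [mG Gkoo] := Goo k; split.
  rewrite -[X in measurable X]setTI.
  by apply: measurable_uncons_rV => //; exact: measurableX.
rewrite /lebesgue_cons /pushforward -comp_preimage.
rewrite (_ : _ \o _ = id); last by apply/funext; exact: cons_rVK.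
by rewrite preimage_id product_measure1E// lte_mul_pinfty// ge0_fin_numE.
Qed.

HB.instance Definition _ := Measure_isSigmaFinite.Build _ _ _ lebesgue_cons
  lebesgue_cons_sigma_finite.

End step.

(* Lebesgue measure on R^n, by recursion on n: the Dirac mass at the unique
   point for n = 0, and the product measure, transported along
   R * R^n = R^n.+1, in the successor case. *)
Fixpoint lebesgue_rV n : {sigma_finite_measure set 'rV[R]_n -> \bar R} :=
  if n is k.+1 then lebesgue_cons (lebesgue_rV k) else \d_(0 : 'rV[R]_0).

(* This characterizes lebesgue_rV. *)
Lemma lebesgue_rV_box n (I : 'I_n -> set (measurableTypeR R)) :
  (forall i, measurable (I i)) ->
  lebesgue_rV n [set x | forall i, I i (x ord0 i)] =
  (\prod_(i < n) lebesgue_measure (I i))%E.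
Proof.
elim: n I => [|n IH] I mI.
  by rewrite big_ord0 /= diracE mem_set//= => -[].
rewrite big_ord_recl -IH; last by move=> i; exact: mI.
rewrite -product_measure1E; [|exact: mI|]; last first.
  by apply: (measurable_box (I := fun i => I (lift ord0 i))) => i; exact: mI.
rewrite [LHS]/= /lebesgue_cons /pushforward; congr (_ _).
rewrite predeqE => -[a x]; split=> /= [h|[h0 h] i].
  split; first by have := h ord0; rewrite mxE unlift_none.
  by move=> i; have := h (lift ord0 i); rewrite mxE liftK.
by case: (unliftP ord0 i) => [j|] ->; rewrite mxE ?liftK ?unlift_none.
Qed.
End lebesgue_rV.

Definition hdim (R : realType) (n : nat) : R := n%:R + 2.

Section grushin_space.
Context {R : realType} {n : nat}.

Local Notation space := ('rV[R]_n * R)%type.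
Implicit Types (u : space -> R) (z : space).

(* Lebesgue integral over R^n.+1, with values in \bar R. *)
Definition intG (F : space -> R) : \bar R :=
  (\int[lebesgue_rV n \x lebesgue_measure]_z (F z)%:E)%E.

(* In finite dimension, C^oo amounts to every iterated directional derivative
   being (Frechet) differentiable everywhere. *)
Definition smooth u :=
  forall (vs : seq space) z, differentiable (foldr (fun v f => 'D_v f) u vs) z.

Definition supp u : set space := closure [set z | u z != 0].

(* Elements of C_0^oo(R^n.+1 \ {o}), extended by zero to R^n.+1. *)
Definition test_function u :=
  [/\ smooth u, compact (supp u) & ~ supp u (0, 0)].

Definition enorm m (x : 'rV[R]_m) : R := Num.sqrt (\sum_i x ord0 i ^+ 2).

Definition rho z : R := (enorm z.1 ^+ 4 + 4 * z.2 ^+ 2) `^ (4^-1).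

Definition dx (i : 'I_n) u : space -> R := 'D_(delta_mx ord0 i, 0) u.
Definition dt u : space -> R := 'D_(0, 1) u.

Definition gradG u z : space := (\row_i dx i u z, enorm z.1 * dt u z).

Definition normG (v : space) : R := Num.sqrt (enorm v.1 ^+ 2 + v.2 ^+ 2).

Definition grad_rho z : R := normG (gradG rho z).

(* psi is the square of grad_rho away from the origin. At the origin, and for
   negative powers on {x = 0}, values are conventional (0^-1 = 0); this is a
   null set. *)
Definition psi z : R := enorm z.1 ^+ 2 / rho z ^+ 2.

(* The derivative in rho of the polar coordinates x = rho * sin(phi)^(1/2) * w,
   t = rho^2 / 2 * cos(phi), with phi and w fixed. *)
Definition drho u z : R :=
  (rho z)^-1 * (\sum_i z.1 ord0 i * dx i u z + 2 * z.2 * dt u z).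

(* Norm of the radial gradient psi^(1/2) * (drho u, 0, 0). *)
Definition norm_grad_radial u z : R := Num.sqrt (psi z) * `|drho u z|.

Definition L_radial u z : R :=
  psi z * (drho (drho u) z + (hdim R n - 1) / rho z * drho u z).

Definition T_op (beta : R) u z : R :=
  grad_rho z * (drho u z + (hdim R n - beta - 2) / (2 * rho z) * u z).

(* T_beta \o T_(beta + 2) \o ... \o T_(beta + 2k). *)
Fixpoint R_op (beta : R) (k : nat) u : space -> R :=
  if k is k'.+1 then T_op beta (R_op (beta + 2) k' u) else T_op beta u.

End grushin_space.

Section constants.
Context {R : realType}.
Implicit Types Q beta mu : R.

(* Only used for i >= 1. *)
Definition Lambda (i : nat) Q beta : R :=
  if i == 1 then ((Q - 2 - beta) / 2) ^+ 2
  else ((Q + beta + 2 * (i%:R - 2)) * (Q - beta - 2 * i%:R) / 4) ^+ 2.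

Definition Cst (k : nat) Q beta : R :=
  if odd k then \prod_(0 <= i < k./2.+1) Lambda (2 * i + 1) Q beta
  else \prod_(1 <= i < k./2.+1) Lambda (2 * i) Q beta.

Definition Acst Q mu : R := ((Q + mu) ^+ 2 + (Q - 4 - mu) ^+ 2) / 4.

Fixpoint Dcst Q (j : int) (m : nat) beta : R :=
  if m is m'.+1 then
    if (0 <= j <= (2 * m' + 2)%:Z) then
      Lambda (2 * m' + 2) Q beta * Dcst Q (j - 2) m' beta
      + Acst Q (beta + 4 * m'%:R) * Dcst Q (j - 1) m' beta
      + Dcst Q j m' beta
    else 0
  else (j == 0)%:R.

Fixpoint Bcst Q (j : int) (m : nat) beta (k : nat) : R :=
  if m is m'.+1 then
    if (0 <= j <= (2 * m' + 2)%:Z) then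
      Lambda 2 Q (beta + 2 * k%:R + 2) * Bcst Q (j - 2) m' (beta + 4) k
      + Acst Q (beta + 2 * k%:R + 2) * Bcst Q (j - 1) m' (beta + 2) k.+1
      + Bcst Q j m' beta k.+2
    else 0
  else (j == 0)%:R.

Definition Dtilde Q (j : int) (l : nat) beta : R :=
  Bcst Q j l beta 0 + (Q - beta - 2) ^+ 2 / 4 * Dcst Q (j - 1) l (beta + 2).

End constants.

(* Main.v *)
(** Let [E] be the Euler field [x . grad_x + 2 t d_t], the generator of the
    dilations [(x, t) -> (r x, r^2 t)]. Then [d_rho = rho^-1 E], [E rho = rho]
    and [E psi = 0], so that away from [x = 0] each operator of the statement is
    a power of [psi] times a power of [rho] times a polynomial in [E]:
    [L^l = psi^l rho^(-2l) prod_(i < l) (E - 2i) (E + Q - 2 - 2i)] and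
    [R_(beta, k) = (psi^(1/2) / rho)^(k+1) (E + (Q - beta - 2 - 2k) / 2)^(k+1)].
    All integrals are therefore of the form [|p(E) u|^2] integrated against
    [psi rho^-b dx dt], with one and the same [b]. Differentiating
    [int f(r z) psi rho^-b = r^(b-Q) int f psi rho^-b] at [r = 1] shows that
    [S = E + (Q - b) / 2] is antisymmetric for this measure, whence
    [|(S - a) v|^2 = |S v|^2 + a^2 |v|^2]. The theorem is the expansion of
    a product of factors [y + a^2] in powers of [y = -S^2]; the constants [D] and
    [B] are its coefficients. *)

Require Import Defs.
From HB Require Import structures.
From mathcomp Require Import all_boot all_order all_algebra.
From mathcomp Require Import all_classical all_reals all_analysis.
From mathcomp Require Import measurable_realfun.
From mathcomp Require Import ring lra zify.
Import Order.TTheory GRing.Theory Num.Theory.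
Import numFieldNormedType.Exports.
Local Open Scope classical_set_scope.
Local Open Scope ring_scope.
Set Implicit Arguments.
Unset Strict Implicit.
Unset Printing Implicit Defensive.

(** * Dilations and Lebesgue measure *)

(** The change of variables is asked of nonnegative extended-real functions only, so that it passes
    to products by Tonelli with no integrability to check. *)
Definition scales_integral (d : measure_display) (T : measurableType d)
    (R : realType) (m : {measure set T -> \bar R}) (phi : T -> T) (c : R) :=
  forall h : T -> \bar R, measurable_fun setT h -> (forall x, (0 <= h x)%E) ->
    (\int[m]_x h (phi x) = c%:E * \int[m]_x h x)%E.

Section scaling.
Context {R : realType}.

Lemma scales_integral_prod (d1 d2 : measure_display) (T1 : measurableType d1)
    (T2 : measurableType d2) (m1 : {sigma_finite_measure set T1 -> \bar R})
    (m2 : {sigma_finite_measure set T2 -> \bar R}) (f1 : T1 -> T1)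
    (f2 : T2 -> T2) (c1 c2 : R) :
  measurable_fun setT f1 -> measurable_fun setT f2 -> 0 <= c1 -> 0 <= c2 ->
  scales_integral m1 f1 c1 -> scales_integral m2 f2 c2 ->
  scales_integral (m1 \x m2)%E (fun z => (f1 z.1, f2 z.2)) (c1 * c2).
Proof.
move=> mf1 mf2 c10 c20 h1 h2 h mh h0.
have mphi : measurable_fun setT (fun z : T1 * T2 => (f1 z.1, f2 z.2)).
  apply: measurable_fun_pair; first exact: measurableT_comp mf1 measurable_fst.
  exact: measurableT_comp mf2 measurable_snd.
have mhphi := measurableT_comp mh mphi.
rewrite (fubini_tonelli1 _ mhphi)//= (fubini_tonelli1 _ mh)//.
rewrite /fubini_F/=.
under eq_integral => x _.
  rewrite (h2 (fun y => h (f1 x, y)))//; last first.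
    apply: (measurableT_comp mh); exact: measurable_pair1.
  over.
have mF := measurable_fun_fubini_tonelli_F (m2 := m2) h mh h0.
rewrite ge0_integralZl//; first last.
- by move=> x _; apply: integral_ge0.
- exact: (measurableT_comp mF mf1).
rewrite (h1 (fun x => \int[m2]_y h (x, y))%E)//.
- by rewrite muleA EFinM (muleC c2%:E).
- by move=> x; apply: integral_ge0.
Qed.

(** Uniqueness of Lebesgue measure: the pushforward under multiplication by [r], rescaled by [r],
    gives each half-open interval its length. *)
Lemma scales_integral_lebesgue (r : R) : 0 < r ->
  scales_integral (@lebesgue_measure R) (fun x => r * x) r^-1.
Proof.
move=> r0 h mh h0.
have mr : measurable_fun setT (fun x : measurableTypeR R => r * x : measurableTypeR R).
  exact: measurable_funM.
have /= <- := ge0_integral_pushforward mr lebesgue_measure measurableT mh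
  (fun y _ => h0 y).
have ri : 0 <= r^-1 by rewrite invr_ge0 ltW.
rewrite -(ge0_integral_mscale _ measurableT (NngNum ri) mh (fun x _ => h0 x)).
apply: eq_measure_integral => /= A mA _.
rewrite /mscale/=.
pose M := measure_function_pushforward__canonical__measure_function_Measure
  lebesgue_measure mr.
suff -> : lebesgue_measure A = mscale (NngNum (ltW r0)) M A.
  by rewrite /mscale/= muleA -EFinM mulVf ?gt_eqF// mul1e.
apply: (@lebesgue_measure_unique R (mscale (NngNum (ltW r0)) M) _ A mA).
move=> /= _ [[a b]] _ <-.
rewrite /mscale/= /pushforward/=.
rewrite (_ : _ @^-1` _ = `]r^-1 * a, r^-1 * b]%classic); last first.
  by apply/seteqP; split => x /=;
    rewrite !in_itv/= !(mulrC r^-1) ltr_pdivrMr// ler_pdivlMr// (mulrC r).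
rewrite !lebesgue_measure_itv/= !lte_fin ltr_pM2l ?invr_gt0//.
case: ifPn => _; last by rewrite mule0.
by rewrite -!EFinB -EFinM -mulrBr mulrA mulfV ?gt_eqF// mul1r.
Qed.

Lemma measurable_scale_rV (n : nat) (r : R) :
  measurable_fun setT (fun x : 'rV[R]_n => r *: x).
Proof.
apply: measurable_fun_rV => i.
rewrite (_ : (fun _ => _) = (fun x : 'rV[R]_n => r * x ord0 i)); last first.
  by apply/funext => x; rewrite mxE.
apply: (@measurable_funM _ _ _ _ (cst r)) => //.
exact: measurable_coord_rV.
Qed.

Lemma scales_integral_rV (n : nat) (r : R) : 0 < r ->
  scales_integral (lebesgue_rV (R := R) n) (fun x => r *: x) (r^-1 ^+ n).
Proof.
move=> r0; elim: n => [|n IH] h mh h0.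
  rewrite expr0 mul1e; apply: eq_integral => x _; congr h.
  by apply/rowP => -[].
have push (g : 'rV[R]_n.+1 -> \bar R) :
    measurable_fun setT g -> (forall x, (0 <= g x)%E) ->
    (\int[lebesgue_rV n.+1]_x g x =
     \int[lebesgue_measure \x lebesgue_rV n]_z g (cons_rV z))%E.
  move=> mg g0.
  have := ge0_integral_pushforward (@measurable_cons_rV R n)
    (lebesgue_measure \x lebesgue_rV n)%E measurableT mg (fun y _ => g0 y).
  by rewrite preimage_setT.
have mhr : measurable_fun setT (fun x : 'rV[R]_n.+1 => h (r *: x)).
  exact: (measurableT_comp mh (@measurable_scale_rV n.+1 r)).
rewrite (push _ mhr)// (push _ mh)//.
have := @scales_integral_prod _ _ _ _ lebesgue_measure (lebesgue_rV n) _ _ _ _ _ _ _ _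
  (scales_integral_lebesgue r0) IH (h \o @cons_rV R n).
rewrite exprS => <-//.
- apply: eq_integral => -[a x] _ /=; congr h; apply/rowP => i; rewrite !mxE /=.
  by case: (unlift ord0 i) => //= j; rewrite mxE.
- exact: measurable_funM.
- exact: measurable_scale_rV.
- by rewrite invr_ge0 ltW.
- by rewrite exprn_ge0// invr_ge0 ltW.
- exact: (measurableT_comp mh (@measurable_cons_rV R n)).
- by move=> x; exact: h0.
Qed.

End scaling.

(** * The Euler field *)

Section calculus.
Context {R : realType} {n : nat}.
Local Notation space := ('rV[R]_n * R)%type.
Implicit Types (f g : space -> R) (z : space).

Definition euler f z : R :=
  \sum_i z.1 ord0 i * dx i f z + 2 * z.2 * dt f z.

Definition dilate (r : R) z : space := (r *: z.1, r ^+ 2 * z.2).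

Lemma diff_partials f z (v : space) : differentiable f z ->
  'd f z v = \sum_i v.1 ord0 i * dx i f z + v.2 * dt f z.
Proof.
move=> df; rewrite /dx /dt.
have vE : v = \sum_i (v.1 ord0 i *: ((delta_mx ord0 i : 'rV[R]_n), 0 : R))
              + v.2 *: ((0 : 'rV[R]_n), 1 : R).
  rewrite [LHS]surjective_pairing [RHS]surjective_pairing; congr pair.
    rewrite /= scaler0 addr0 raddf_sum/= [LHS]row_sum_delta.
    by apply: eq_bigr.
  rewrite /= raddf_sum/= big1 ?add0r; last by move=> i _ /=; rewrite scaler0.
  by rewrite [RHS]mulr1.
rewrite {1}vE linearD linear_sum linearZ /= deriveE//; congr (_ + _).
by apply: eq_bigr => i _; rewrite linearZ deriveE.
Qed.

Lemma euler_derive f z : differentiable f z ->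
  euler f z = 'D_(z.1, 2 * z.2) f z.
Proof. by move=> df; rewrite deriveE// diff_partials. Qed.

(** In exponential time the dilations form a one-parameter group, so the chain rule gives the
    generator at the moving point for every [s], not only at [s = 0]. *)
Lemma is_derive_flow f z (s : R) : differentiable f (dilate (expR s) z) ->
  is_derive s 1 (fun s => f (dilate (expR s) z)) (euler f (dilate (expR s) z)).
Proof.
move=> df.
have dexp : differentiable (@expR R) s by exact/derivable1_diffP.
have exp2E : (fun s : R => expR s ^+ 2) = (@expR R) ^+ 2.
  by apply/funext => x; rewrite exprfctE.
have dexp2 : differentiable (fun s : R => expR s ^+ 2) s.
  rewrite exp2E.
  exact: differentiableX.
have d1 : differentiable (fun s : R => expR s *: z.1) s.
  exact: differentiableZl.
have d2 : differentiable (fun s : R => expR s ^+ 2 *: z.2) s.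
  exact: differentiableZl.
have dg : differentiable (fun s : R => dilate (expR s) z) s.
  exact: differentiable_pair.
have dfg : differentiable (f \o (fun s : R => dilate (expR s) z)) s.
  exact: differentiable_comp.
apply: DeriveDef; first exact/derivable1_diffP.
rewrite deriveE// (diff_comp dg df)/= euler_derive// deriveE//.
congr ('d f _ _).
rewrite (diff_pair d1 d2); congr pair.
  rewrite diffZl//= -deriveE//.
  by have /(@derive_val _ _ _ _ _ _ _) -> := is_derive_expR s.
rewrite diffZl//= -deriveE// -[LHS]/(_ * _).
rewrite (_ : 'D_1 _ s = 2 * expR s ^+ 2) ?mulrA//.
rewrite exp2E deriveX//.
have /(@derive_val _ _ _ _ _ _ _) -> := is_derive_expR s.
rewrite expr1 /GRing.scale/= -mulr_natl; ring.
Qed.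

Lemma derive_expR_scale (c k : R) :
  'D_1 (fun s : R => expR (c * s) * k) 0 = c * k.
Proof.
have -> : (fun s : R => expR (c * s) * k) = k *: (@expR R \o (fun s => c * s)).
  by apply/funext => s; rewrite mulrC.
rewrite deriveZ/=; last first.
  apply: diff_derivable; apply: differentiable_comp => //.
  exact/derivable1_diffP.
rewrite -derive1E derive1_comp// !derive1E.
have /(@derive_val _ _ _ _ _ _ _) -> := is_derive_expR (c * 0).
rewrite mulr0 expR0 mul1r.
have -> : (fun s : R => c * s) = c *: id by [].
by rewrite deriveZ// derive_id mulrC /GRing.scale/= mulr1.
Qed.

(** Euler's identity: differentiate the homogeneity at [s = 0]. *)
Lemma euler_homogeneous f z (c : R) : differentiable f z ->
  (forall s, f (dilate (expR s) z) = expR (c * s) * f z) -> euler f z = c * f z.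
Proof.
move=> df hf.
have d0 : dilate (expR 0) z = z.
  by rewrite /dilate expR0 scale1r expr1n mul1r -surjective_pairing.
have := @is_derive_flow f z 0; rewrite d0 => /(_ df) h1.
rewrite -(@derive_val _ _ _ _ _ _ _ h1) -derive_expR_scale.
by congr ('D_(1 : R) _ _); apply/funext.
Qed.

Lemma euler_mul f g z : differentiable f z -> differentiable g z ->
  euler (fun y => f y * g y) z = euler f z * g z + f z * euler g z.
Proof.
move=> df dg; rewrite !euler_derive//; last exact: differentiableM.
have -> : (fun y => f y * g y) = f * g by [].
rewrite deriveM//; try exact: diff_derivable.
by rewrite addrC /GRing.scale/= (mulrC (g z)).
Qed.

Lemma euler_near f g z : (\near z, f z = g z) -> euler f z = euler g z.
Proof.
move=> fg; rewrite /euler /dx /dt; congr (_ + _ * _); last exact: near_eq_derive.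
by apply: eq_bigr => i _; congr (_ * _); exact: near_eq_derive.
Qed.

Lemma drhoE f z : drho f z = (rho z)^-1 * euler f z.
Proof. by []. Qed.

(* Suited to induction, unlike [smooth]: [euler] costs one order. *)
Fixpoint smooth_upto (m : nat) f : Prop :=
  if m is k.+1 then
    (forall z, differentiable f z) /\ (forall v, smooth_upto k ('D_v f))
  else forall z, differentiable f z.

Lemma smooth_upto_diff m f : smooth_upto m f -> forall z, differentiable f z.
Proof. by case: m => [|m]; [exact: id|case=> df _]. Qed.

Lemma smooth_uptoS m f : smooth_upto m.+1 f -> smooth_upto m f.
Proof.
elim: m f => [|m IH] f; first by case.
by move=> [df h]; split => // v; exact/IH/h.
Qed.

Lemma smooth_smooth_upto m f : smooth f -> smooth_upto m f.
Proof.
move=> sf; have /= df := sf [::].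
elim: m f sf df => [|m IH] f sf df //=; split => // v.
apply: IH => [vs z|]; last exact: (sf [:: v]).
by have := sf (rcons vs v) z; rewrite -cats1 foldr_cat.
Qed.

Lemma smooth_upto_add m f g : smooth_upto m f -> smooth_upto m g ->
  smooth_upto m (f + g).
Proof.
elim: m f g => [|m IH] f g; first by move=> df dg z; exact: differentiableD.
move=> [df hf] [dg hg]; split=> [z|v]; first exact: differentiableD.
have -> : 'D_v (f + g) = 'D_v f + 'D_v g; last exact: IH (hf v) (hg v).
by apply/funext => z; rewrite deriveD//; exact: diff_derivable.
Qed.

Lemma smooth_upto_scale m (a : R) f : smooth_upto m f -> smooth_upto m (a *: f).
Proof.
elim: m f => [|m IH] f; first by move=> df z; exact: differentiableZ.
move=> [df hf]; split=> [z|v]; first exact: differentiableZ.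
have -> : 'D_v (a *: f) = a *: 'D_v f; last exact: IH (hf v).
by apply/funext => z; rewrite deriveZ//; exact: diff_derivable.
Qed.

Lemma smooth_upto0 m : smooth_upto m 0.
Proof.
elim: m => [|m IH]; first by move=> z; exact: differentiable_cst.
split=> [z|v]; first exact: differentiable_cst.
have -> // : 'D_v (0 : space -> R) = 0.
by apply/funext => z; exact: derive_cst.
Qed.

Lemma smooth_upto_sum m (I : Type) (r : seq I) (F : I -> space -> R) :
  (forall i, smooth_upto m (F i)) -> smooth_upto m (\sum_(i <- r) F i).
Proof.
move=> h; elim/big_ind : _ => //; [exact: smooth_upto0|exact: smooth_upto_add].
Qed.

(** The coefficients of [euler] are coordinates, whose directional derivatives are constant, so the
    product rule never costs more than one order of [f] per derivative. *)
Lemma smooth_upto_mul_linear m (l : space -> R) f :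
  (forall z, differentiable l z) ->
  (forall v z, 'D_v l z = l v) -> smooth_upto m f -> smooth_upto m (l * f).
Proof.
move=> dl Dl; elim: m f => [|m IH] f; first by move=> df z; exact: differentiableM.
move=> [df hf]; split=> [z|v]; first exact: differentiableM.
have -> : 'D_v (l * f) = l v *: f + l * 'D_v f; last first.
  apply: smooth_upto_add; last exact/IH/hf.
  by apply: smooth_upto_scale; exact: (@smooth_uptoS m f (conj df hf)).
apply/funext => z; rewrite deriveM; try exact: diff_derivable.
by rewrite Dl addrC /GRing.scale/= (mulrC (f z)).
Qed.

Lemma differentiable_coordx (i : 'I_n) z :
  differentiable (fun y : space => y.1 ord0 i) z.
Proof.
apply: (@differentiable_comp _ _ _ _ fst (fun M : 'rV[R]_n => M ord0 i)).
  by apply: linear_differentiable => y; exact: cvg_fst.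
exact: differentiable_coord.
Qed.

Lemma derive_coordx (i : 'I_n) (v z : space) :
  'D_v (fun y : space => y.1 ord0 i) z = v.1 ord0 i.
Proof.
rewrite /derive; apply: cvg_lim => //; apply: (@cvg_trans _ ((fun=> v.1 ord0 i) @ 0^')).
  apply: near_eq_cvg; near=> h; rewrite /= !mxE addrK.
  rewrite /GRing.scale/= mulrA mulVf ?mul1r//.
  by near: h; exact: nbhs_dnbhs_neq.
exact: cvg_cst.
Unshelve. all: end_near. Qed.

Lemma differentiable_coordt z : differentiable (fun y : space => y.2) z.
Proof. by apply: linear_differentiable => y; exact: cvg_snd. Qed.

Lemma derive_coordt (v z : space) : 'D_v (fun y : space => y.2) z = v.2.
Proof.
rewrite /derive; apply: cvg_lim => //; apply: (@cvg_trans _ ((fun=> v.2) @ 0^')).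
  apply: near_eq_cvg; near=> h; rewrite /= addrK.
  rewrite /GRing.scale/= mulrA mulVf ?mul1r//.
  by near: h; exact: nbhs_dnbhs_neq.
exact: cvg_cst.
Unshelve. all: end_near. Qed.

Lemma smooth_upto_euler m f : smooth_upto m.+1 f -> smooth_upto m (euler f).
Proof.
move=> [df hf].
have -> : euler f = \sum_(i < n) ((fun y : space => y.1 ord0 i) * dx i f)
                    + 2 *: ((fun y : space => y.2) * dt f).
  apply/funext => z; rewrite /euler -[RHS]/(_ z + _) fct_sumE; congr (_ + _).
  by rewrite -mulrA.
apply: smooth_upto_add.
  apply: smooth_upto_sum => i; apply: smooth_upto_mul_linear (hf _).
    exact: differentiable_coordx.
  exact: derive_coordx.
apply: smooth_upto_scale; apply: smooth_upto_mul_linear (hf _).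
  exact: differentiable_coordt.
exact: derive_coordt.
Qed.

End calculus.

(** * The homogeneous norm *)

Section gauge.
Context {R : realType} {n : nat}.
Local Notation space := ('rV[R]_n * R)%type.
Implicit Types (f g : space -> R) (z : space).

Definition sqx z : R := \sum_i z.1 ord0 i ^+ 2.

Lemma sqx_ge0 z : 0 <= sqx z.
Proof. by apply: sumr_ge0 => i _; exact: sqr_ge0. Qed.

Lemma enorm_sqx z : enorm z.1 ^+ 2 = sqx z.
Proof. by rewrite sqr_sqrtr ?sqx_ge0. Qed.

Lemma sqx_eq0 z : (sqx z == 0) = (z.1 == 0).
Proof.
apply/idP/eqP => [|z0]; last first.
  by rewrite /sqx z0 big1// => i _; rewrite mxE expr0n.
rewrite psumr_eq0 => [/allP h|i _]; last exact: sqr_ge0.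
apply/rowP => i; have := h i (mem_index_enum i).
by rewrite sqrf_eq0 mxE => /eqP.
Qed.

Lemma rhoE z : rho z = (sqx z ^+ 2 + 4 * z.2 ^+ 2) `^ 4^-1.
Proof. by rewrite /rho -[4%N]/(2 * 2)%N exprM enorm_sqx. Qed.

Lemma rho_ge0 z : 0 <= rho z.
Proof. exact: powR_ge0. Qed.

Let quartic_ge0 z : 0 <= sqx z ^+ 2 + 4 * z.2 ^+ 2.
Proof. by rewrite addr_ge0 ?sqr_ge0// mulr_ge0// sqr_ge0. Qed.

Let quartic_gt0 z : z != 0 -> 0 < sqx z ^+ 2 + 4 * z.2 ^+ 2.
Proof.
move=> z0; rewrite lt_def quartic_ge0 andbT; apply: contra z0.
have h : 0 <= 4 * z.2 ^+ 2 by rewrite mulr_ge0// sqr_ge0.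
rewrite paddr_eq0 ?sqr_ge0// sqrf_eq0 sqx_eq0 => /andP[/eqP z1].
rewrite mulf_eq0 pnatr_eq0/= sqrf_eq0 => /eqP z2.
by rewrite [z]surjective_pairing z1 z2.
Qed.

Lemma rho_gt0 z : z != 0 -> 0 < rho z.
Proof. by move=> z0; rewrite rhoE powR_gt0 ?quartic_gt0. Qed.

Lemma rho0 : rho (0 : space) = 0.
Proof.
rewrite rhoE (_ : sqx 0 = 0) ?expr0n/= ?mulr0 ?addr0 ?powR0//.
by apply/eqP; rewrite sqx_eq0.
Qed.

Lemma rho_expr4 z : rho z ^+ 4 = sqx z ^+ 2 + 4 * z.2 ^+ 2.
Proof.
by rewrite rhoE -powR_mulrn ?powR_ge0// -powRrM mulVf// powRr1.
Qed.

Lemma sqx_dilate (r : R) z : sqx (dilate r z) = r ^+ 2 * sqx z.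
Proof.
by rewrite /sqx mulr_sumr; apply: eq_bigr => i _; rewrite mxE exprMn.
Qed.

Lemma rho_dilate (r : R) z : 0 <= r -> rho (dilate r z) = r * rho z.
Proof.
move=> r0; rewrite !rhoE sqx_dilate /=.
rewrite (_ : _ + _ = r ^+ 4 * (sqx z ^+ 2 + 4 * z.2 ^+ 2)); last by ring.
rewrite powRM ?exprn_ge0//; congr (_ * _).
by rewrite -powR_mulrn// -powRrM mulfV// powRr1.
Qed.

Lemma enorm_dilate (r : R) z : 0 <= r -> enorm (dilate r z).1 = r * enorm z.1.
Proof.
move=> r0; have e y : enorm y.1 = Num.sqrt (sqx y) by [].
rewrite !e sqx_dilate sqrtrM ?sqr_ge0//.
by rewrite sqrtr_sqr ger0_norm.
Qed.

Lemma psiE z : psi z = (enorm z.1 / rho z) ^+ 2.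
Proof. by rewrite expr_div_n. Qed.

Lemma sqrt_psi z : Num.sqrt (psi z) = enorm z.1 / rho z.
Proof.
by rewrite psiE sqrtr_sqr ger0_norm// divr_ge0 ?rho_ge0// sqrtr_ge0.
Qed.

Lemma differentiable_sqx z : differentiable sqx z.
Proof.
rewrite (_ : sqx = \sum_(i < n) (fun y : space => y.1 ord0 i) ^+ 2); last first.
  by apply/funext => y; rewrite fct_sumE; apply: eq_bigr => i _; rewrite exprfctE.
apply: differentiable_sum => i; apply: differentiableX.
exact: differentiable_coordx.
Qed.

Lemma derive_sqx z (v : space) :
  'D_v sqx z = 2 * \sum_i z.1 ord0 i * v.1 ord0 i.
Proof.
rewrite (_ : sqx = \sum_(i < n) (fun y : space => y.1 ord0 i) ^+ 2); last first.
  by apply/funext => y; rewrite fct_sumE; apply: eq_bigr => i _; rewrite exprfctE.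
have dx i : derivable (fun y : space => y.1 ord0 i) z v.
  exact/diff_derivable/differentiable_coordx.
rewrite derive_sum => [|i]; last exact: derivableX.
rewrite mulr_sumr; apply: eq_bigr => i _.
by rewrite deriveX// derive_coordx expr1 /GRing.scale/= -mulr_natl mulrA.
Qed.

Let quartic := fun z : space => sqx z ^+ 2 + 4 * z.2 ^+ 2.

Let quarticE : quartic = sqx ^+ 2 + 4 *: ((fun y : space => y.2) ^+ 2).
Proof.
by apply/funext => y; rewrite -[RHS]/(_ y + 4 * _) !exprfctE.
Qed.

Let differentiable_quartic z : differentiable quartic z.
Proof.
rewrite quarticE; apply: differentiableD.
  exact/differentiableX/differentiable_sqx.
apply: differentiableZ; apply: differentiableX; exact: differentiable_coordt.
Qed.

Lemma differentiable_rho z : z != 0 -> differentiable (@rho R n) z.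
Proof.
move=> z0.
rewrite (_ : @rho R n = (fun x : R => x `^ 4^-1) \o quartic); last first.
  by apply/funext => y; rewrite /= rhoE.
apply: differentiable_comp => //; apply/derivable1_diffP.
by apply: derivable_powR; rewrite in_itv/= andbT quartic_gt0.
Qed.

Lemma derive_rho z (v : space) : z != 0 ->
  'D_v (@rho R n) z =
  (sqx z * (\sum_i z.1 ord0 i * v.1 ord0 i) + 2 * z.2 * v.2) / rho z ^+ 3.
Proof.
move=> z0; have r0 : rho z != 0 by rewrite gt_eqF ?rho_gt0.
have drho : derivable (@rho R n) z v by exact/diff_derivable/differentiable_rho.
have dq : derivable sqx z v by exact/diff_derivable/differentiable_sqx.
have dt : derivable (fun y : space => y.2) z v.
  exact/diff_derivable/differentiable_coordt.
(* The fourth power of [rho] is a polynomial; comparing the two derivatives and dividing by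
   [4 rho^3] gives the derivative of [rho]. *)
have : 'D_v ((@rho R n) ^+ 4) z = 'D_v quartic z.
  by congr ('D_v _ z); apply/funext => y; rewrite exprfctE rho_expr4.
rewrite deriveX// quarticE deriveD; last 2 first.
- exact: derivableX.
- exact/derivableZ/derivableX.
rewrite deriveX// deriveZ; last exact: derivableX.
rewrite deriveX// derive_sqx derive_coordt /GRing.scale/= !expr1 => h.
apply: (mulfI (_ : 4 * rho z ^+ 3 != 0)); first by rewrite mulf_neq0// expf_neq0.
rewrite h; field.
by rewrite r0.
Qed.

Lemma grad_rhoE z : z != 0 -> grad_rho z = enorm z.1 / rho z.
Proof.
move=> z0; have r0 : rho z != 0 by rewrite gt_eqF ?rho_gt0.
rewrite -sqrt_psi /grad_rho /normG; congr Num.sqrt.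
rewrite /gradG/= exprMn enorm_sqx.
rewrite [enorm _ ^+ 2](@sqr_sqrtr); last by apply: sumr_ge0 => i _; exact: sqr_ge0.
have -> : dt (@rho R n) z = 2 * z.2 / rho z ^+ 3.
  rewrite /dt derive_rho//= big1; last by move=> i _; rewrite mxE mulr0.
  by rewrite mulr0 add0r mulr1.
under eq_bigr => i _.
  rewrite mxE /dx derive_rho//= (bigD1 i)//= mxE !eqxx mulr1 big1; last first.
    by move=> j ji; rewrite mxE (negbTE ji) andbF mulr0.
  rewrite addr0 mulr0 addr0 mulrAC exprMn.
  over.
rewrite -mulr_sumr -/(sqx z) /psi enorm_sqx.
have h := rho_expr4 z.
(* The [x] and [t] parts of the gradient share the factor [|x|^2 / rho^6]; what remains is the
   quartic, which equals [rho^4]. *)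
transitivity (sqx z * (sqx z ^+ 2 + 4 * z.2 ^+ 2) / rho z ^+ 6).
  by field; rewrite r0.
by rewrite -h; field; rewrite r0.
Qed.

Lemma differentiable_enorm z : z.1 != 0 ->
  differentiable (fun y : space => enorm y.1) z.
Proof.
move=> z0; rewrite (_ : (fun _ => _) = Num.sqrt \o sqx)//.
apply: differentiable_comp; first exact: differentiable_sqx.
have q0 : 0 < sqx z by rewrite lt_def sqx_ge0 sqx_eq0 z0.
apply/derivable1_diffP; apply: ex_derive.
by apply: is_derive1_sqrt.
Qed.

End gauge.

(** * Polynomials in the Euler field *)

Definition radial_poly (R : realType) (Q : R) (l : nat) : {poly R} :=
  \prod_(i < l) (('X - (2 * i%:R)%:P) * ('X + (Q - 2 - 2 * i%:R)%:P)).

Section euler_polynomials.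
Context {R : realType} {n : nat}.
Local Notation space := ('rV[R]_n * R)%type.
Variable u : space -> R.
Hypothesis su : smooth u.
Implicit Types (p q : {poly R}) (f : space -> R) (z : space).

(* The function [p(E) u]. *)
Definition peuler p z : R := \sum_(i < size p) p`_i * iter i euler u z.

Lemma peuler_widen N p z : (size p <= N)%N ->
  peuler p z = \sum_(i < N) p`_i * iter i euler u z.
Proof.
move=> pN; rewrite /peuler (big_ord_widen N (fun i => p`_i * iter i euler u z))//.
rewrite big_mkcond; apply: eq_bigr => i _; case: ifPn => //.
by rewrite -leqNgt => /leq_sizeP ->//; rewrite mul0r.
Qed.

Lemma peulerD p q z : peuler (p + q) z = peuler p z + peuler q z.
Proof.
pose N := maxn (size p) (size q).
rewrite !(@peuler_widen N) ?leq_maxl ?leq_maxr ?size_polyD//.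
by rewrite -big_split; apply: eq_bigr => i _; rewrite coefD mulrDl.
Qed.

Lemma peulerZ (a : R) p z : peuler (a *: p) z = a * peuler p z.
Proof.
rewrite (@peuler_widen (size p)) ?size_scale_leq// mulr_sumr.
by apply: eq_bigr => i _; rewrite coefZ mulrA.
Qed.

Lemma peulerXaddC (c : R) p z :
  peuler (('X + c%:P) * p) z = peuler ('X * p) z + c * peuler p z.
Proof. by rewrite mulrDl peulerD mul_polyC peulerZ. Qed.

Lemma peuler1 z : peuler 1 z = u z.
Proof. by rewrite /peuler size_poly1 big_ord1 coef1 mul1r. Qed.

Lemma smooth_iter_euler i m : smooth_upto m (iter i euler u).
Proof.
elim: i m => [|i IH] m; first exact: smooth_smooth_upto.
exact/smooth_upto_euler/IH.
Qed.

Let fpeuler p : peuler p = \sum_(i < size p) (p`_i *: iter i euler u).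
Proof. by apply/funext => z; rewrite fct_sumE. Qed.

Lemma differentiable_peuler p z : differentiable (peuler p) z.
Proof.
rewrite fpeuler; apply: differentiable_sum => i; apply: differentiableZ.
exact: (@smooth_upto_diff _ _ 0 _ (smooth_iter_euler i 0)).
Qed.

(** This makes [p] to [p(E) u] compatible with multiplication by ['X], so that composing operators
    becomes multiplying polynomials. *)
Lemma euler_peuler p z : euler (peuler p) z = peuler ('X * p) z.
Proof.
have du i : differentiable (iter i euler u) z.
  exact: (@smooth_upto_diff _ _ 0 _ (smooth_iter_euler i 0)).
rewrite (@peuler_widen (size p).+1); last first.
  by rewrite mulrC (leq_trans (size_polyMleq _ _))// size_polyX addn2.
rewrite big_ord_recl coefXM mul0r add0r euler_derive; last first.
  exact: differentiable_peuler.
rewrite fpeuler derive_sum => [|i]; last exact/diff_derivable/differentiableZ.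
apply: eq_bigr => i _; rewrite coefXM/= deriveZ; last exact: diff_derivable.
by rewrite -euler_derive.
Qed.

(* [sin^(1/2) phi] in polar coordinates, i.e. [|grad_G rho|] off the origin. *)
Definition angular z : R := enorm z.1 / rho z.

Let neq0x z : z.1 != 0 -> z != 0.
Proof. by apply: contra => /eqP ->. Qed.

Lemma near_neq0x z : z.1 != 0 -> \near z, z.1 != 0.
Proof.
move=> z0.
have cq := differentiable_continuous (differentiable_sqx z).
have q0 : sqx z != 0 by rewrite sqx_eq0.
have h := cvgr_neq0 _ cq q0.
by near=> y; rewrite -sqx_eq0; near: y; exact: h.
Unshelve. all: end_near. Qed.

Let weight a b z := angular z ^+ a / rho z ^+ b.

Let differentiable_exp f k z : differentiable f z -> differentiable (f ^+ k) z.
Proof.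
case: k => [_|k]; [exact: differentiable_cst|exact: differentiableX].
Qed.

Let differentiable_weight a b z : z.1 != 0 -> differentiable (weight a b) z.
Proof.
move=> z0; have r0 : rho z != 0 by rewrite gt_eqF// rho_gt0// neq0x.
have dr := differentiable_rho (neq0x z0).
have -> : weight a b = (angular ^+ a) * (fun y => ((@rho R n ^+ b) y)^-1).
  by apply/funext => y; rewrite -[RHS]/(_ y * _) !exprfctE.
have dangular : differentiable angular z.
  apply: differentiableM; first exact: differentiable_enorm.
  exact: differentiableV.
have drb : differentiable (@rho R n ^+ b) z by exact: differentiable_exp.
apply: differentiableM; first exact: differentiable_exp.
by apply: differentiableV => //; rewrite exprfctE expf_neq0.
Qed.

(** Under dilations [angular] has degree 0 and [rho] has degree 1. *)
Let euler_weight a b z : z.1 != 0 -> euler (weight a b) z = - b%:R * weight a b z.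
Proof.
move=> z0; apply: euler_homogeneous; first exact: differentiable_weight.
move=> s; have r0 : rho z != 0 by rewrite gt_eqF// rho_gt0// neq0x.
have e0 : expR s != 0 by rewrite gt_eqF ?expR_gt0.
rewrite /weight /angular enorm_dilate ?expR_ge0// rho_dilate ?expR_ge0//.
rewrite (_ : expR (- b%:R * s) = (expR s ^+ b)^-1); last first.
  by rewrite mulNr expRN expRM_natl.
rewrite (_ : expR s * enorm z.1 / (expR s * rho z) = enorm z.1 / rho z).
  by rewrite [(expR s * rho z) ^+ b]exprMn invfM mulrCA.
by rewrite invfM mulrACA mulfV// mul1r.
Qed.

(** Moving [E] past a function of degree [-b] turns it into [E - b]; the factor [rho^-1] of [drho]
    raises the exponent to [b + 1], and [angular] passes through. *)
Lemma drho_weight (a b : nat) p (f : space -> R) z :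
  (forall y, y.1 != 0 -> f y = angular y ^+ a / rho y ^+ b * peuler p y) ->
  z.1 != 0 ->
  drho f z = angular z ^+ a / rho z ^+ b.+1 * peuler (('X - b%:R%:P) * p) z.
Proof.
move=> hf z0; have r0 : rho z != 0 by rewrite gt_eqF// rho_gt0// neq0x.
rewrite drhoE (@euler_near _ _ _ (fun y => weight a b y * peuler p y)); last first.
  by apply: filterS (near_neq0x z0) => y /hf.
rewrite euler_mul; [|exact: differentiable_weight|exact: differentiable_peuler].
rewrite euler_weight// euler_peuler -polyCN peulerXaddC.
rewrite /weight exprS invfM; ring.
Qed.

Lemma iter_L_radialE l z : z.1 != 0 ->
  iter l L_radial u z =
  angular z ^+ (2 * l) / rho z ^+ (2 * l) * peuler (radial_poly (hdim R n) l) z.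
Proof.
elim: l z => [|l IH] z z0.
  by rewrite /radial_poly big_ord0 peuler1 muln0 !expr0 divr1 mul1r.
have r0 : rho z != 0 by rewrite gt_eqF// rho_gt0// neq0x.
have h1 y (y0 : y.1 != 0) := drho_weight IH y0.
rewrite iterS /L_radial (drho_weight h1 z0) (h1 z z0) psiE -/(angular z).
set Q := hdim R n.
(* With [v = (X - 2l) P], the second derivative gives [(X - (2l + 1)) v] and the first-order term
   gives [(Q - 1) v]; they add up to [(X + Q - 2 - 2l) v]. *)
rewrite (_ : radial_poly Q l.+1 =
    ('X - (2 * l).+1%:R%:P) * (('X - (2 * l)%:R%:P) * radial_poly Q l)
    + (Q - 1) *: (('X - (2 * l)%:R%:P) * radial_poly Q l)); last first.
  rewrite /radial_poly big_ord_recr/= -/(radial_poly Q l).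
  rewrite -mul_polyC mulrA -mulrDl mulrC.
  rewrite -natr1 natrM !polyCD !polyCN.
  ring.
rewrite peulerD peulerZ mulnS !exprS invfM.
by field; rewrite expf_neq0.
Qed.

(** All [k + 1] factors coincide: each outer [T_op] has its parameter lower by 2, which adds 1 to
    its constant, and meets one more power of [rho], which subtracts 1. *)
Lemma R_opE (beta : R) k z : z.1 != 0 ->
  R_op beta k u z = angular z ^+ k.+1 / rho z ^+ k.+1 *
    peuler (('X + ((hdim R n - beta - 2 - 2 * k%:R) / 2)%:P) ^+ k.+1) z.
Proof.
have step b (c : R) j p f y : (forall y, y.1 != 0 ->
    f y = angular y ^+ j / rho y ^+ j * peuler p y) -> y.1 != 0 ->
    c = (hdim R n - b - 2) / 2 - j%:R ->
    T_op b f y = angular y ^+ j.+1 / rho y ^+ j.+1 * peuler (('X + c%:P) * p) y.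
  move=> hf y0 ->; have r0 : rho y != 0 by rewrite gt_eqF// rho_gt0// neq0x.
  rewrite /T_op grad_rhoE ?neq0x// -/(angular y) (drho_weight hf y0) hf//.
  rewrite (_ : 'X + _%:P = 'X - j%:R%:P + ((hdim R n - b - 2) / 2)%:P); last first.
    by rewrite polyCB; ring.
  rewrite [in RHS]mulrDl peulerD mul_polyC peulerZ !exprS invfM.
  by field; rewrite ?expf_neq0 ?r0.
elim: k beta z => [|k IH] beta z z0.
  rewrite [LHS]/= (step beta ((hdim R n - beta - 2 - 2 * 0%:R) / 2) 0%N 1)//.
  - by rewrite mulr1 expr1.
  - by move=> y _; rewrite !expr0 divr1 mul1r peuler1.
  - by rewrite mulr0 !subr0.
rewrite [LHS]/= (step beta _ k.+1 _ _ _ (IH _) z0 erefl).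
rewrite (_ : _ - k.+1%:R = (hdim R n - (beta + 2) - 2 - 2 * k%:R) / 2).
  rewrite -exprS; congr (_ * peuler (('X + _%:P) ^+ _) z).
  by rewrite -natr1; ring.
by rewrite -natr1; field.
Qed.

End euler_polynomials.

(** * The constants as coefficients *)

Section recursion.
Context {R : realType}.
Implicit Types (Q beta : R) (j : int).

Lemma Dcst_out Q j m beta : ~~ (0 <= j <= (2 * m)%:Z) -> Dcst Q j m beta = 0.
Proof.
case: m => [|m] /=.
  by case: eqP => // -> /negP[]; rewrite lexx.
by rewrite mulnS addnC => /negbTE ->.
Qed.

(** Outside the range of [j] the three terms on the right vanish as well, so the recursion holds
    without the range test. *)
Lemma DcstS Q j m beta : Dcst Q j m.+1 beta =
  Lambda (2 * m + 2) Q beta * Dcst Q (j - 2) m beta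
  + Acst Q (beta + 4 * m%:R) * Dcst Q (j - 1) m beta + Dcst Q j m beta.
Proof.
rewrite /=; case: ifPn => // hj.
rewrite !Dcst_out ?mulr0 ?addr0//; apply: contra hj; lia.
Qed.

Lemma LambdaE Q i beta :
  Lambda (2 * i + 2) Q beta =
  ((Q + beta + 4 * i%:R) * (Q - beta - 4 * i%:R - 4) / 4) ^+ 2.
Proof.
rewrite /Lambda (_ : (2 * i + 2 == 1)%N = false); last by lia.
by congr (_ ^+ 2); field.
Qed.

Lemma Lambda_shift Q i beta : Lambda (2 * i.+1 + 2) Q beta =
  Lambda (2 * i + 2) Q (beta + 4).
Proof.
by rewrite !LambdaE; congr (_ ^+ 2); field.
Qed.

(* [Dcst] is defined by splitting off the last factor of the product over [m] of
   [y^2 + Acst (beta + 4m) y + Lambda (2m + 2) beta]; splitting off the first one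
   instead gives the recursion of [Bcst]. *)
Lemma DcstS_low Q j m beta : Dcst Q j m.+1 beta =
  Lambda 2 Q beta * Dcst Q (j - 2) m (beta + 4)
  + Acst Q beta * Dcst Q (j - 1) m (beta + 4) + Dcst Q j m (beta + 4).
Proof.
elim: m j => [|m IH] j.
  by rewrite DcstS muln0 add0n mulr0 addr0.
rewrite DcstS !IH !DcstS Lambda_shift.
rewrite (_ : beta + 4 * m.+1%:R = beta + 4 + 4 * m%:R); last by ring.
rewrite (_ : j - 2 - 1 = j - 1 - 2); last by lia.
ring.
Qed.

(** [Bcst] depends on [beta] and [k] only through [beta + 2k + 2]: each of its three recursive calls
    raises this quantity by 4, as in [DcstS_low]. *)
Lemma Bcst_Dcst Q j m beta k :
  Bcst Q j m beta k = Dcst Q j m (beta + 2 * k%:R + 2).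
Proof.
elim: m j beta k => [|m IH] j beta k //.
have [hj|hj] := boolP (0 <= j <= (2 * m + 2)%:Z); last first.
  by rewrite /= (negbTE hj).
rewrite DcstS_low [LHS]/= hj !IH.
have e1 : beta + 4 + 2 * k%:R + 2 = beta + 2 * k%:R + 2 + 4 by ring.
have e2 : beta + 2 + 2 * k.+1%:R + 2 = beta + 2 * k%:R + 2 + 4 by ring.
have e3 : beta + 2 * k.+2%:R + 2 = beta + 2 * k%:R + 2 + 4 by ring.
by rewrite e1 e2 e3.
Qed.

(** At the top index only the [Lambda] term of the recursion stays in range, so this coefficient is
    the product of the constant terms of the quadratics. *)
Lemma Dcst_top Q l beta : Dcst Q (2 * l)%:Z l beta = Cst (2 * l) Q beta.
Proof.
rewrite /Cst mul2n odd_double doubleK.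
elim: l => [|l IH]; first by rewrite big_geq.
rewrite DcstS big_nat_recr//= -IH.
rewrite [Dcst _ (_ - 1) _ _]Dcst_out ?mulr0 ?addr0; last by lia.
rewrite [Dcst _ (l.+1.*2)%:Z _ _]Dcst_out ?addr0; last by lia.
rewrite mulrC; congr (Dcst _ _ _ _ * Lambda _ _ _); lia.
Qed.

(** The [Bcst] term is out of range here. The prefactor of the other term is [Lambda 1], and raising
    [beta] by 2 in [Lambda (2i)] gives [Lambda (2i + 1)]. *)
Lemma Dtilde_top Q l beta : Dtilde Q (2 * l + 1)%:Z l beta = Cst (2 * l + 1) Q beta.
Proof.
rewrite /Dtilde Bcst_Dcst Dcst_out ?add0r; last by lia.
rewrite (_ : (2 * l + 1)%:Z - 1 = (2 * l)%:Z); last by lia.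
rewrite Dcst_top /Cst mul2n odd_double addn1 /= odd_double/= uphalf_double doubleK.
rewrite big_add1 [in RHS]big_nat_recl//=; congr (_ * _).
  by rewrite /Lambda/=; field.
rewrite [LHS]big_nat [RHS]big_nat; apply: eq_bigr => i _.
rewrite /Lambda !ifN; try lia.
by congr (_ ^+ 2); field.
Qed.

(** Only the indices from [c] to [2l + c] contribute. This brings the terms of the recursion, with
    their shifts of [j], to a common range of summation. *)
Lemma Dcst_sum_shift Q (l c N : nat) beta (a : nat -> R) :
  (2 * l + c < N)%N ->
  \sum_(j < N) Dcst Q (j%:Z - c%:Z) l beta * a j =
  \sum_(j < (2 * l).+1) Dcst Q j%:Z l beta * a (j + c)%N.
Proof.
move=> hN.
rewrite -(big_mkord xpredT (fun j : nat => Dcst Q (j%:Z - c%:Z) l beta * a j)).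
rewrite -(big_mkord xpredT (fun j : nat => Dcst Q j%:Z l beta * a (j + c)%N)).
rewrite (big_cat_nat (n := c))//=; last by lia.
rewrite big1_seq ?add0r; last first.
  move=> j; rewrite mem_index_iota => /= hj.
  by rewrite Dcst_out ?mul0r//; lia.
rewrite (big_cat_nat (n := (2 * l).+1 + c)%N)//=; last by lia.
rewrite [X in _ + X]big1_seq ?addr0; last first.
  move=> j; rewrite mem_index_iota => /= hj.
  by rewrite Dcst_out ?mul0r//; lia.
rewrite -{1}[c]add0n big_addn addnK; apply: eq_bigr => j _.
by rewrite PoszD addrK.
Qed.

Lemma Dcst_sum_widen Q (l N : nat) beta (a : nat -> R) :
  (2 * l < N)%N ->
  \sum_(j < N) Dcst Q j%:Z l beta * a j =
  \sum_(j < (2 * l).+1) Dcst Q j%:Z l beta * a j.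
Proof.
move=> lN; have := @Dcst_sum_shift Q l 0 N beta a; rewrite addn0 => /(_ lN) h.
transitivity (\sum_(j < N) Dcst Q (j%:Z - 0%:Z) l beta * a j).
  by apply: eq_bigr => j _; rewrite subr0.
by rewrite h; apply: eq_bigr => j _; rewrite addn0.
Qed.

End recursion.

(** * Symmetric bilinear forms on polynomials for which ['X + kappa] is antisymmetric *)

Section quadratic_form.
Context {R : realType}.
Variables (B : {poly R} -> {poly R} -> R) (kappa : R).
Hypothesis BD : forall p p' q, B (p + p') q = B p q + B p' q.
Hypothesis BZ : forall a p q, B (a *: p) q = a * B p q.
Hypothesis BC : forall p q, B p q = B q p.
Hypothesis BX : forall p q, B ('X * p) q + B p ('X * q) = - (2 * kappa) * B p q.
Implicit Types (p q : {poly R}) (a : R).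

Local Notation S := ('X + kappa%:P).

Let BXC a p q : B (('X + a%:P) * p) q = B ('X * p) q + a * B p q.
Proof. by rewrite mulrDl BD mul_polyC BZ. Qed.

Lemma antisymmetric_shift p q : B (S * p) q = - B p (S * q).
Proof.
rewrite BXC (BC p (S * q)) BXC (BC _ p) (BC q p); have := BX p q; lra.
Qed.

Lemma form_factor a p :
  B ((S + a%:P) * p) ((S + a%:P) * p) = B (S * p) (S * p) + a ^+ 2 * B p p.
Proof.
have e q : B ((S + a%:P) * p) q = B (S * p) q + a * B p q.
  by rewrite mulrDl BD mul_polyC BZ.
rewrite !e (BC (S * p)) (BC p) !e (BC p (S * p)).
(* The cross term [B (S p) p] vanishes by antisymmetry. *)
have := antisymmetric_shift p p; rewrite (BC p (S * p)) => h.
have -> : B (S * p) p = 0 by lra.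
ring.
Qed.

(** Two uses of [form_factor]. Only squares of the shifts survive, which produces the quadratic
    [y^2 + (a^2 + a'^2) y + (a a')^2] in [y = -S^2]. *)
Lemma form_factor2 a a' p :
  let q := (S - a%:P) * (S + a'%:P) * p in
  B q q = B (S ^+ 2 * p) (S ^+ 2 * p)
    + (a ^+ 2 + a' ^+ 2) * B (S * p) (S * p) + (a * a') ^+ 2 * B p p.
Proof.
rewrite /= -mulrA -polyCN form_factor mulrCA !form_factor sqrrN.
have -> : S ^+ 2 * p = S * (S * p) by rewrite expr2 mulrA.
ring.
Qed.

Lemma form_even (Q beta : R) l p :
  let q := (\prod_(m < l) ((S - ((Q - 4 - beta - 4 * m%:R) / 2)%:P)
                    * (S + ((Q + beta + 4 * m%:R) / 2)%:P))) * p in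
  B q q = \sum_(j < (2 * l).+1) Dcst Q j%:Z l beta *
            B (S ^+ (2 * l - j) * p) (S ^+ (2 * l - j) * p).
Proof.
elim: l p => [|l IH] p; cbv zeta.
  by rewrite big_ord0 mul1r big_ord1 /= !mul1r.
rewrite big_ord_recr [LHS]/=; set P := \prod_(m < l) _.
set g := _ / 2; set h := (Q + _ + _) / 2.
(* The last pair of factors is expanded first; the induction hypothesis then applies to [P] with
   [S^2 p], [S p] and [p] in the place of [p]. *)
rewrite [P * _]mulrC -mulrA form_factor2 ![_ * (P * p)]mulrCA !IH.
have -> : g ^+ 2 + h ^+ 2 = Acst Q (beta + 4 * l%:R).
  by rewrite /g /h /Acst; field.
have -> : (g * h) ^+ 2 = Lambda (2 * l + 2) Q beta.
  by rewrite LambdaE /g /h; field.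
under [RHS]eq_bigr do rewrite DcstS.
move: (Acst _ _) (Lambda _ _ _) => A L.
under [RHS]eq_bigr do rewrite !mulrDl -!mulrA.
pose a j := B (S ^+ (2 * l.+1 - j) * p) (S ^+ (2 * l.+1 - j) * p).
rewrite !big_split/= -!mulr_sumr.
rewrite (Dcst_sum_shift Q beta a (c := 2)); last by lia.
rewrite (Dcst_sum_shift Q beta a (c := 1)); last by lia.
rewrite (Dcst_sum_widen Q beta a); last by lia.
(* After reindexing by [j + c], the exponent [2(l + 1) - (j + c)] is [(2l - j) + (2 - c)]; the cases
   [c = 0, 1, 2] match the arguments [S^2 p], [S p] and [p]. *)
rewrite -[RHS]addrA [RHS]addrC [X in _ = X + _]addrC; congr (_ + _ * _ + _ * _);
  apply: eq_bigr => j _; rewrite /a; have := ltn_ord j => hj.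
- rewrite (mulrA _ (S ^+ 2)) -exprD.
  by rewrite (_ : 2 * l.+1 - j = 2 * l - j + 2)%N//; lia.
- rewrite (mulrA _ S) -exprSr.
  by rewrite (_ : 2 * l.+1 - (j + 1) = (2 * l - j).+1)%N//; lia.
- by rewrite (_ : 2 * l.+1 - (j + 2) = 2 * l - j)%N//; lia.
Qed.

Lemma form_radial_poly_even (Q beta : R) (l : nat) p :
  kappa = (Q - beta - 4 * l%:R) / 2 ->
  B (radial_poly Q l * p) (radial_poly Q l * p) =
  \sum_(j < (2 * l).+1) Dcst (Q) j%:Z l beta *
    B (S ^+ (2 * l - j) * p) (S ^+ (2 * l - j) * p).
Proof.
(* Written in terms of [S], the factor of index [i] in [radial_poly] is the factor of index
   [l - 1 - i] in [form_even], so the product is reversed. *)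
move=> hk; rewrite -form_even (reindex_inj rev_ord_inj)/=.
suff -> : radial_poly Q l = \prod_(j < l)
    (('X + kappa%:P - ((Q - 4 - beta - 4 * (l - j.+1)%:R) / 2)%:P) *
     ('X + kappa%:P + ((Q + beta + 4 * (l - j.+1)%:R) / 2)%:P)) by [].
apply: eq_bigr => i _; rewrite natrB ?ltn_ord// -natr1.
rewrite -!addrA -!polyCN -!polyCD hk.
by congr (('X + _%:P) * ('X + _%:P)); field.
Qed.

(** The extra factor [X - 2l] is [S - (Q - beta - 2) / 2]. Splitting it off by [form_factor] leaves
    two even cases at [beta + 2], whose coefficients are the two terms of [Dtilde]. *)
Lemma form_radial_poly_odd (Q beta : R) (l : nat) :
  kappa = (Q - beta - 4 * l%:R - 2) / 2 ->
  let q := ('X - (2 * l)%:R%:P) * radial_poly Q l in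
  B q q = \sum_(j < (2 * l).+2) Dtilde (Q) j%:Z l beta *
            B (S ^+ (2 * l + 1 - j)) (S ^+ (2 * l + 1 - j)).
Proof.
move=> hk /=.
have hk2 : kappa = (Q - (beta + 2) - 4 * l%:R) / 2 by rewrite hk; field.
rewrite (_ : 'X - _ = S + (- (Q - beta - 2) / 2)%:P); last first.
  by rewrite -addrA -polyCN -polyCD hk natrM; congr ('X + _%:P); field.
(* The even case is used with [p = S] for the first term and with [p = 1] for the second. *)
rewrite form_factor mulrC -[radial_poly Q l in X in _ + X]mulr1.
rewrite !(form_radial_poly_even _ hk2).
under [RHS]eq_bigr do rewrite /Dtilde Bcst_Dcst mulr0 addr0.
have -> : (- (Q - beta - 2) / 2) ^+ 2 = (Q - beta - 2) ^+ 2 / 4 by field.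
move: (_ / 4) => K; under [RHS]eq_bigr do rewrite mulrDl -(mulrA K).
pose a j := B (S ^+ (2 * l + 1 - j)) (S ^+ (2 * l + 1 - j)).
rewrite big_split/= -!mulr_sumr.
rewrite (Dcst_sum_shift Q (beta + 2) a (c := 1)); last by lia.
rewrite (Dcst_sum_widen Q (beta + 2) a); last by lia.
congr (_ + _).
  apply: eq_bigr => j _; have hj := ltn_ord j.
  by rewrite -exprSr /a (_ : 2 * l + 1 - j = (2 * l - j).+1)%N//; lia.
congr (_ * _).
apply: eq_bigr => j _; have hj := ltn_ord j.
by rewrite mulr1 /a (_ : 2 * l + 1 - (j + 1) = 2 * l - j)%N//; lia.
Qed.

End quadratic_form.

(** * Measurability of continuous functions *)

(** The preimage is a countable union of fibres of [p]. Step functions on a grid of cells are of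
    this kind. *)
Lemma measurable_countable_factor (d d' : measure_display)
    (T : measurableType d) (U : measurableType d') (C : countType) (p : T -> C)
    (g : C -> U) :
  (forall c, measurable (p @^-1` [set c])) -> measurable_fun setT (g \o p).
Proof.
move=> mp _ Y mY; rewrite setTI.
rewrite (_ : _ @^-1` _ =
    \bigcup_(c : C) (p @^-1` [set c] `&` [set _ | Y (g c)])); last first.
  apply/seteqP; split => [x /= Yx|x [c _ [/= <-]]//].
  by exists (p x).
apply: countable_bigcupT_measurable; first exact: countableP.
move=> c; apply: measurableI => //.
have [Yc|nYc] := pselect (Y (g c)).
  by rewrite (_ : [set _ | _] = setT)//; apply/seteqP; split.
by rewrite (_ : [set _ | _] = set0)//; apply/seteqP; split.
Qed.

Section continuous_measurable.
Context {R : realType} {n : nat}.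
Local Notation space := ('rV[R]_n * R)%type.

Let cell (k : nat) (z : space) : 'rV[int]_n * int :=
  (map_mx (fun x : R => Num.floor (x * k.+1%:R)) z.1, Num.floor (z.2 * k.+1%:R)).

Let corner (k : nat) (c : 'rV[int]_n * int) : space :=
  (map_mx (fun m : int => m%:~R / k.+1%:R) c.1, c.2%:~R / k.+1%:R).

Let measurable_floor_fiber (k : nat) (m : int) :
  measurable [set x : measurableTypeR R | Num.floor (x * k.+1%:R) = m].
Proof.
rewrite (_ : [set _ | _] = `[m%:~R / k.+1%:R, (m + 1)%:~R / k.+1%:R[%classic).
  exact: measurable_itv.
apply/seteqP; split => x /=; rewrite in_itv/= ler_pdivrMr// ltr_pdivlMr//.
  by move=> /eqP; rewrite floor_eq.
by rewrite -floor_eq => /eqP.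
Qed.

Let measurable_cell k c : measurable (cell k @^-1` [set c]).
Proof.
case: c => c1 c2.
rewrite (_ : _ @^-1` _ =
    [set x : 'rV[R]_n |
      forall i, [set y | Num.floor (y * k.+1%:R) = c1 ord0 i] (x ord0 i)]
    `*` [set y | Num.floor (y * k.+1%:R) = c2]).
  apply: measurableX; last exact: measurable_floor_fiber.
  apply: (measurable_box
    (I := fun i => [set y | Num.floor (y * k.+1%:R) = c1 ord0 i])) => i.
  exact: measurable_floor_fiber.
apply/seteqP; split => -[x t] /=.
  by move=> [<- <-]; split => // i; rewrite mxE.
by move=> [h <-]; congr pair; apply/rowP => i; rewrite mxE.
Qed.

Let dist_corner (k : nat) (x : R) :
  `|x - (Num.floor (x * k.+1%:R))%:~R / k.+1%:R| < k.+1%:R^-1 *+ 2.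
Proof.
have k0 : 0 < k.+1%:R :> R by [].
have := floor_itv (x * k.+1%:R) => /andP[h1 h2].
rewrite ger0_norm ?subr_ge0 ?ler_pdivrMr//.
apply: (@lt_le_trans _ _ (k.+1%:R^-1)); last by rewrite mulr2n lerDl invr_ge0.
rewrite ltrBlDr -[X in X + _]mul1r -mulrDl ltr_pdivlMr//.
by rewrite addrC -[1]/(1%:~R) -intrD.
Qed.

(* [f] is the pointwise limit of its values at the lower corners of the cells of
   a grid of mesh [1 / (k + 1)]. *)
Lemma continuous_measurable (f : space -> R) :
  continuous f -> measurable_fun setT f.
Proof.
move=> cf; apply: (@measurable_fun_cvg _ _ _ _ (fun k => f \o (corner k \o cell k))).
  by move=> k; exact: (measurable_countable_factor (f \o corner k) (measurable_cell k)).
move=> z _; suff h : (fun k => corner k (cell k z)) @ \oo --> (z : space).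
  exact: (cvg_comp _ _ h (cf z)).
apply/cvg_ballP => e e0.
have e20 : 0 < e / 2 by rewrite divr_gt0.
near=> k.
have ke : k.+1%:R^-1 *+ 2 < e.
  rewrite -[X in X < _]mulr_natr -ltr_pdivlMr//; near: k.
  exact: (near_infty_natSinv_lt (PosNum e20)).
split=> [|/=].
  by split=> // i j; rewrite /ball/= !mxE (lt_trans _ ke)// ord1.
by rewrite /ball/= (lt_trans _ ke).
Unshelve. all: end_near. Qed.

End continuous_measurable.

(** * Bounded functions of compact support *)

(** Continuity is asked only at points of [K], because the weights may be singular at the origin,
    which lies outside the support. *)
Lemma compact_support_bounded (R : realType) (T : topologicalType) (K : set T)
    (f : T -> R) : compact K -> (forall z, K z -> {for z, continuous f}) ->
  (forall z, ~ K z -> f z = 0) -> exists2 C : R, 0 <= C & forall z, `|f z| <= C.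
Proof.
move=> cK cf f0; have [[z0 Kz0]|K0] := pselect (K !=set0); last first.
  exists 0 => // z; rewrite f0 ?normr0// => Kz; apply: K0; by exists z.
have [||c cK' hc] := @compact_EVT_max T R (fun z => `|f z|) K _ cK.
- by exists z0.
- apply: continuous_in_subspaceT => z /set_mem Kz.
  exact: (continuous_comp (cf z Kz) (@norm_continuous _ _ _)).
exists `|f c| => // z; have [Kz|nKz] := pselect (K z); last by rewrite f0// normr0.
exact/hc/mem_set.
Qed.

Section scales_real.
Context (d : measure_display) (T : measurableType d) (R : realType).
Variables (m : {measure set T -> \bar R}) (phi : T -> T) (c : R).
Hypothesis mphi : measurable_fun setT phi.
Hypothesis hphi : scales_integral m phi c.

Lemma scales_integrable (f : T -> R) : m.-integrable setT (EFin \o f) ->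
  m.-integrable setT (EFin \o (f \o phi)).
Proof.
move=> /integrableP[mf foo]; apply/integrableP; split.
  exact: (measurableT_comp mf mphi).
rewrite (hphi (h := fun x => `|(EFin \o f) x|%E))//; last first.
  exact: measurableT_comp.
have : (0 <= \int[m]_x `|(EFin \o f) x|)%E by exact: integral_ge0.
by move: (\int[m]_x _)%E foo => [r|//|//] _ _; rewrite -EFinM ltry.
Qed.

(** The scaling of nonnegative functions is applied to the positive and the negative part;
    integrability makes both integrals finite. *)
Lemma scales_Rintegral (f : T -> R) : m.-integrable setT (EFin \o f) ->
  (\int[m]_x f (phi x))%R = (c * \int[m]_x f x)%R.
Proof.
move=> intf; have mf := measurable_int _ intf.
rewrite /Rintegral integralE [in RHS]integralE.
have hp := hphi (measurable_funepos mf) (fun x => funepos_ge0 _ x).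
have hn := hphi (measurable_funeneg mf) (fun x => funeneg_ge0 _ x).
have fp := integrable_pos_fin_num measurableT intf.
have fn := integrable_neg_fin_num measurableT intf.
transitivity (fine (c%:E * (\int[m]_x (EFin \o f)^\+ x)
                    - c%:E * (\int[m]_x (EFin \o f)^\- x))%E).
  congr (fine (_ - _)%E); [rewrite -hp|rewrite -hn]; apply: eq_integral => x _.
    by rewrite !funeposE.
  by rewrite !funenegE.
by rewrite -(fineK fp) -(fineK fn) -!EFinM /= mulrBr.
Qed.

End scales_real.

(** * Dilations and integrability on the Grushin space *)

Section grushin_integral.
Context {R : realType} {n : nat}.
Local Notation space := ('rV[R]_n * R)%type.
Implicit Types (f g : space -> R) (z : space).

Local Notation mu := (lebesgue_rV (R := R) n \x @lebesgue_measure R)%E.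

Lemma measurable_dilate (r : R) :
  measurable_fun [set: 'rV[R]_n * measurableTypeR R]
    (dilate r : _ -> 'rV[R]_n * measurableTypeR R).
Proof.
apply: measurable_fun_pair.
  exact: (measurableT_comp (@measurable_scale_rV R n r) measurable_fst).
exact: (measurable_funM (measurable_cst _) measurable_snd).
Qed.

(** The horizontal variables contribute [r^-n] and the vertical one [r^-2]: this is where the
    homogeneous dimension [Q = n + 2] enters. *)
Lemma scales_integral_dilate (r : R) : 0 < r ->
  scales_integral mu (@dilate R n r) (r ^- (n + 2)).
Proof.
move=> r0.
have := @scales_integral_prod _ _ _ _ _ (lebesgue_rV n) lebesgue_measure _ _ _ _ _ _ _ _
  (@scales_integral_rV R n r r0) (scales_integral_lebesgue (exprn_gt0 2 r0)).
have -> : r ^- (n + 2) = r^-1 ^+ n * (r ^+ 2)^-1.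
  by rewrite -exprVn exprD (exprVn r 2).
apply.
- exact: measurable_scale_rV.
- exact: measurable_funM.
- by rewrite exprn_ge0// invr_ge0 ltW.
- by rewrite invr_ge0 exprn_ge0// ltW.
Qed.

Definition box (M : R) : set space :=
  [set x : 'rV[R]_n | forall i, `[- M, M]%classic (x ord0 i)] `*` `[- M, M]%classic.

Lemma measurable_boxR M : measurable (box M).
Proof.
apply: measurableX; last exact: measurable_itv.
by apply: (measurable_box (I := fun=> `[- M, M]%classic)) => i; exact: measurable_itv.
Qed.

Lemma integrable_bounded_box (F : space -> R) (C M : R) :
  measurable_fun setT F -> 0 <= C -> (forall z, `|F z| <= C) ->
  (forall z, F z != 0 -> box M z) -> mu.-integrable setT (EFin \o F).
Proof.
move=> mF C0 hC hM.
have mB := measurable_boxR M.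
have muB : (mu (box M) < +oo)%E.
  rewrite product_measure1E; last 2 first.
  - by apply: (measurable_box (I := fun=> `[- M, M]%classic)) => i; exact: measurable_itv.
  - exact: measurable_itv.
  have := @lebesgue_rV_box R n (fun=> `[- M, M]%classic) (fun=> measurable_itv _).
  rewrite /= => ->.
  have lI : (lebesgue_measure (`[(- M)%R, M]%classic : set R) < +oo)%E.
    by rewrite lebesgue_measure_itv/=; case: ifP => _; rewrite ?ltry// -EFinB ltry.
  rewrite lte_mul_pinfty// ?prode_ge0//.
  rewrite prode_fin_num// => i _.
  by rewrite ge0_fin_numE.
have intB : mu.-integrable setT (fun z => C%:E * (\1_(box M) z)%:E)%E.
  apply: integrableZl => //; apply/integrableP; split.
    exact/measurable_EFinP/measurable_indic.
  under eq_integral do rewrite gee0_abs ?lee_fin//.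
  by rewrite integral_indic// setIT.
apply: (le_integrable measurableT _ _ intB).
- exact/measurable_EFinP.
- move=> z _; rewrite /= lee_fin normrM (ger0_norm C0).
  have [Fz|Fz] := eqVneq (F z) 0; first by rewrite Fz normr0 mulr_ge0.
  rewrite indicE mem_set/=; last exact: hM.
  by rewrite [`|1|]normr1 mulr1.
Qed.

End grushin_integral.

(** * Integration by parts along the dilations *)

Section weight.
Context {R : realType} {n : nat}.
Local Notation space := ('rV[R]_n * R)%type.
Implicit Types (f g : space -> R) (z : space) (b : R).

(** This is [psi rho^-b] with the powers of [rho] merged: a polynomial times one real power, so that
    homogeneity, continuity off the origin and measurability can be read off. *)
Definition weight b z : R := sqx z * rho z `^ (- (b + 2)).

Lemma weightE b z : weight b z = psi z / rho z `^ b.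
Proof.
rewrite /weight /psi enorm_sqx; have [->|z0] := eqVneq z 0.
  by rewrite (_ : sqx 0 = 0) ?mul0r//; apply/eqP; rewrite sqx_eq0.
have r0 : rho z != 0 by rewrite gt_eqF ?rho_gt0.
rewrite -mulrA; congr (_ * _).
by rewrite powRN powRD ?r0 ?implybT// powR_mulrn ?rho_ge0// invfM mulrC.
Qed.

Lemma weight_dilate b (s : R) z :
  weight b (dilate (expR s) z) = expR (- b * s) * weight b z.
Proof.
rewrite /weight sqx_dilate rho_dilate ?expR_ge0// powRM ?expR_ge0 ?rho_ge0//.
rewrite -expRM -expRM_natl mulrACA -expRD; congr (expR _ * _); ring.
Qed.

Lemma continuous_sqx : continuous (@sqx R n).
Proof. by move=> z; exact: differentiable_continuous (differentiable_sqx z). Qed.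

Lemma measurable_rho : measurable_fun setT (@rho R n).
Proof.
rewrite (_ : @rho R n =
    (fun x : R => x `^ 4^-1) \o (fun z => sqx z ^+ 2 + 4 * z.2 ^+ 2)); last first.
  by apply/funext => z; rewrite /= rhoE.
apply: measurableT_comp; first exact: measurable_powR.
apply: measurable_funD.
  apply: measurable_funX; exact: continuous_measurable continuous_sqx.
by apply: measurable_funM => //; exact: measurable_funX.
Qed.

Lemma measurable_weight b : measurable_fun setT (weight b).
Proof.
apply: measurable_funM; first exact: continuous_measurable continuous_sqx.
exact: measurableT_comp (measurable_powR _) measurable_rho.
Qed.

Lemma continuous_weight b z : z != 0 -> {for z, continuous (weight b)}.
Proof.
move=> z0; apply: continuousM; first exact: continuous_sqx.
apply: differentiable_continuous.
apply: (@differentiable_comp _ _ _ _ (@rho R n) (fun x : R => x `^ (- (b + 2)))).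
  exact: differentiable_rho.
apply/derivable1_diffP; apply: derivable_powR.
by rewrite in_itv/= andbT rho_gt0.
Qed.

End weight.

Section integration_by_parts.
Context {R : realType} {n : nat}.
Local Notation space := ('rV[R]_n * R)%type.
Local Notation mu := (lebesgue_rV (R := R) n \x @lebesgue_measure R)%E.
Implicit Types (f g : space -> R) (z : space) (b : R).
Variable K : set space.
Hypotheses (cK : compact K) (K0 : ~ K (0, 0)).

Let K_neq0 z : K z -> z != 0.
Proof. by move=> Kz; apply/eqP => z0; apply: K0; rewrite -[(0, 0)]/(0 : space) -z0. Qed.

Lemma compact_box : exists2 M : R, 0 <= M & K `<=` box M.
Proof.
have [[z0 Kz0]|nK] := pselect (K !=set0); last first.
  by exists 0 => // z Kz; case: nK; exists z.
pose h (z : space) : R := sqx z + z.2 ^+ 2.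
have h0 z : 0 <= h z by rewrite addr_ge0 ?sqx_ge0 ?sqr_ge0.
have [||c _ hc] := @compact_EVT_max space R h K _ cK; first by exists z0.
  apply: continuous_subspaceT => z; apply: continuousD; first exact: continuous_sqx.
  apply: differentiable_continuous.
  rewrite (_ : (fun _ => _) = (fun y : space => y.2) ^+ 2); last first.
    by apply/funext => y; rewrite exprfctE.
  exact/differentiableX/differentiable_coordt.
(* [h c] is the maximum of the squared Euclidean norm on [K], and [h c + 1] bounds its square
   root. *)
have bnd (x : R) z : K z -> x ^+ 2 <= h z -> `[- (h c + 1), h c + 1]%classic x.
  move=> Kz xz; rewrite /= in_itv/= -ler_norml.
  have : x ^+ 2 <= h c by apply: le_trans xz _; exact/hc/mem_set.
  rewrite -real_normK ?num_real//; have := normr_ge0 x; have := h0 c; nra.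
exists (h c + 1); first by rewrite addr_ge0.
move=> z Kz; split=> /= [i|]; apply: (bnd _ z) => //.
  rewrite /h /sqx (bigD1 i)//= -!addrA lerDl addr_ge0 ?sqr_ge0//.
  by apply: sumr_ge0 => j _; exact: sqr_ge0.
by rewrite /h lerDr sqx_ge0.
Qed.

Lemma weight_bounded b f : continuous f -> (forall z, ~ K z -> f z = 0) ->
  exists2 C : R, 0 <= C & forall z, `|weight b z * f z| <= C.
Proof.
move=> cf f0; apply: (@compact_support_bounded _ _ K) => //.
  move=> z Kz; apply: continuousM; last exact: cf.
  exact/continuous_weight/K_neq0.
by move=> z nKz; rewrite f0// mulr0.
Qed.

Lemma integrable_weight b f : continuous f -> (forall z, ~ K z -> f z = 0) ->
  mu.-integrable setT (EFin \o (fun z => weight b z * f z)).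
Proof.
move=> cf f0; have [C C0 hC] := weight_bounded b cf f0.
have [M M0 KM] := compact_box.
apply: (@integrable_bounded_box _ _ _ C M) => //.
  apply: measurable_funM; [exact: measurable_weight|exact: continuous_measurable].
move=> z; apply: contra_neqP => nz; rewrite f0 ?mulr0//.
by move=> /KM.
Qed.

(** Since the weight has degree [-b], the whole integrand can be moved to the dilated point, where
    the change of variables applies. *)
Lemma weight_flow b f (s : R) z : weight b z * f (dilate (expR s) z) =
  expR (b * s) * (weight b (dilate (expR s) z) * f (dilate (expR s) z)).
Proof. by rewrite weight_dilate !mulrA -expRD mulNr subrr expR0 mul1r. Qed.

Lemma integrable_flow b f (s : R) : continuous f -> (forall z, ~ K z -> f z = 0) ->
  mu.-integrable setT (EFin \o (fun z => weight b z * f (dilate (expR s) z))).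
Proof.
move=> cf f0.
have h := scales_integrable (measurable_dilate (expR s))
  (scales_integral_dilate (expR_gt0 s)) (integrable_weight b cf f0).
apply: eq_integrable (integrableZl measurableT (expR (b * s)) h) => //.
by move=> z _; rewrite /= -EFinM -weight_flow.
Qed.

(** The exponent collects [b s] from the weight and [-Q s] from the Jacobian of the dilation. *)
Lemma integral_flow b f (s : R) : continuous f -> (forall z, ~ K z -> f z = 0) ->
  \int[mu]_z (weight b z * f (dilate (expR s) z)) =
  expR ((b - hdim R n) * s) * \int[mu]_z (weight b z * f z).
Proof.
move=> cf f0; have intf := integrable_weight b cf f0.
have e0 := expR_gt0 s.
have h := scales_Rintegral (scales_integral_dilate e0) intf.
transitivity (\int[mu]_z (expR (b * s) *
    (weight b (dilate (expR s) z) * f (dilate (expR s) z)))).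
  by apply: eq_Rintegral => z _; rewrite weight_flow.
have h2 := scales_integrable (measurable_dilate (expR s))
  (scales_integral_dilate e0) intf.
rewrite RintegralZl//.
rewrite h mulrA; congr (_ * _).
by rewrite -expRM_natl -expRN -expRD /hdim natrD; congr expR; ring.
Qed.

(* The derivative of [integral_flow] at [s = 0]. *)
Lemma integral_euler b f : (forall z, differentiable f z) ->
  continuous (euler f) -> (forall z, ~ K z -> f z = 0) ->
  (forall z, ~ K z -> euler f z = 0) ->
  \int[mu]_z (weight b z * euler f z) =
  (b - hdim R n) * \int[mu]_z (weight b z * f z).
Proof.
move=> df ce f0 e0.
have cf : continuous f by move=> z; exact: differentiable_continuous.
pose F (s : R) z := weight b z * f (dilate (expR s) z).
have dF (s : R) z :
    is_derive s (1 : R) (F ^~ z) (weight b z * euler f (dilate (expR s) z)).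
  have h := is_derive_flow (df (dilate (expR s) z)).
  exact: is_deriveZ.
have dil0 z : dilate (expR 0) z = z.
  by rewrite /dilate expR0 scale1r expr1n mul1r -surjective_pairing.
have [M M0 KM] := compact_box.
have [C C0 hC] := weight_bounded b ce e0.
(* A dominating function for [|s| < 1]: [C] bounds the weighted [euler f], [expR |b|] bounds the
   factor of [weight_flow], and [expR 2] enlarges the box because [t] is scaled by
   [expR (2 * s)]. *)
pose G z : R := (C * expR `|b|) * \1_(box (expR 2 * M)) z.
have G0 z : 0 <= G z by rewrite !mulr_ge0 ?expR_ge0.
have indic_le1 A z : 0 <= (\1_A z : R) <= 1.
  by rewrite indicE; case: (_ \in _); rewrite lexx ler01.
have intG : mu.-integrable setT (EFin \o G).
  apply: (@integrable_bounded_box _ _ _ (C * expR `|b|) (expR 2 * M)).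
  - by apply: measurable_funM => //; apply: measurable_indic; exact: measurable_boxR.
  - by rewrite mulr_ge0 ?expR_ge0.
  - move=> z; have /andP[i0 i1] := indic_le1 (box (expR 2 * M)) z.
    by rewrite (ger0_norm (G0 z)) /G ler_piMr ?mulr_ge0 ?expR_ge0.
  - move=> z; apply: contra_neqP => nz; rewrite /G indicE memNset// mulr0 //.
have G_ub s z : s \in `](-1), 1[ -> `|weight b z * euler f (dilate (expR s) z)| <= G z.
  rewrite in_itv/= => /andP[s1 s2].
  have [Kz|nKz] := pselect (K (dilate (expR s) z)); last by rewrite e0// mulr0 normr0.
  rewrite /G indicE mem_set; last first.
    have := KM _ Kz; rewrite /box /= => -[h1 h2].
    have bnd (r x : R) : - 2 <= r -> `[- M, M]%classic (expR r * x) ->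
        `[- (expR 2 * M), expR 2 * M]%classic x.
      move=> r2; rewrite /= !in_itv/= -!ler_norml normrM ger0_norm ?expR_ge0// => h.
      rewrite (_ : `|x| = expR (- r) * (expR r * `|x|)); last first.
        by rewrite mulrA -expRD addNr expR0 mul1r.
      by rewrite ler_pM ?expR_ge0 ?mulr_ge0 ?expR_ge0// ler_expR lerNl.
    split=> [i|]; first by apply: (bnd s); [lra|have := h1 i; rewrite mxE].
    by apply: (bnd (2 * s)); [lra|rewrite expRM_natl].
  rewrite mulr1 weight_flow normrM [X in X <= _]mulrC ler_pM//.
  rewrite ger0_norm ?expR_ge0// ler_expR (le_trans (ler_norm _))// normrM.
  by rewrite ler_piMr// ler_norml; apply/andP; split; exact: ltW.
have dF1 : partial1of2 F 0 = fun z => weight b z * euler f z.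
  apply/funext => z; rewrite partial1of2E.
  by rewrite (@derive_val _ _ _ _ _ _ _ (dF 0 z)) dil0.
have intF (s : R) : `](-1), 1[%classic s -> mu.-integrable setT (EFin \o F s).
  by move=> _; exact: integrable_flow.
have derF (s : R) z : `](-1), 1[%classic s -> setT z -> derivable (F ^~ z) s 1.
  by move=> _ _; exact: (@ex_derive _ _ _ _ _ _ _ (dF s z)).
have F1_ub (s : R) z : `](-1), 1[%classic s -> setT z -> `|partial1of2 F s z| <= G z.
  move=> hs _; rewrite partial1of2E (@derive_val _ _ _ _ _ _ _ (dF s z)).
  exact: G_ub.
have I0 : `](-1), 1[%classic (0 : R) by rewrite /= in_itv/= ltrN10 ltr01.
have := @differentiation_under_integral R _ _ mu F setT measurableT 0 (-1) 1
  I0 intF derF G G0 intG F1_ub.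
(* By [integral_flow] the integral is an explicit exponential in [s], whose derivative at 0 supplies
   the factor [b - Q]. *)
rewrite (_ : (fun x' => _) = (fun s => expR ((b - hdim R n) * s) *
    \int[mu]_z (weight b z * f z))); last first.
  by apply/funext => s; exact: integral_flow.
rewrite derive1E derive_expR_scale => ->.
by apply: eq_Rintegral => z _; rewrite dF1.
Qed.

End integration_by_parts.

(** * The identity *)

Section test_function_form.
Context {R : realType} {n : nat}.
Local Notation space := ('rV[R]_n * R)%type.
Local Notation mu := (lebesgue_rV (R := R) n \x @lebesgue_measure R)%E.
Variable u : space -> R.
Hypothesis hu : test_function u.
Implicit Types (p q : {poly R}) (f : space -> R) (z : space) (b beta : R).

Let su : smooth u. Proof. by case: hu. Qed.
Let cK : compact (supp u). Proof. by case: hu. Qed.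
Let K0 : ~ supp u (0, 0). Proof. by case: hu. Qed.

(** [E] is a local operator, and the complement of the support is open. *)
Let iter_euler_supp i z : ~ supp u z -> iter i euler u z = 0.
Proof.
elim: i z => [|i IH] z nz.
  apply/eqP; apply: contra_notT nz => uz; exact: subset_closure.
rewrite iterS (@euler_near _ _ _ (cst 0)).
  rewrite /euler big1 => [|j _]; first by rewrite /dt derive_cst mulr0 addr0.
  by rewrite /dx derive_cst mulr0.
have oc : open (~` supp u) by apply: closed_openC; exact: closed_closure.
by have := open_nbhs_nbhs (conj oc nz); apply: filterS => y /IH.
Qed.

Let peuler_supp p z : ~ supp u z -> peuler u p z = 0.
Proof.
by move=> nz; rewrite /peuler big1// => i _; rewrite iter_euler_supp// mulr0.
Qed.

Let continuous_peuler p : continuous (peuler u p).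
Proof. by move=> z; exact/differentiable_continuous/differentiable_peuler. Qed.

(** This is the form [B] of the algebraic part, with [kappa = (Q - b) / 2]. *)
Definition radial_form b p q : R :=
  \int[mu]_z (weight b z * (peuler u p z * peuler u q z)).

Let integrable_form b p q :
  mu.-integrable setT (EFin \o (fun z => weight b z * (peuler u p z * peuler u q z))).
Proof.
apply: (integrable_weight cK K0).
  by move=> z; apply: continuousM; exact: continuous_peuler.
by move=> z nz; rewrite peuler_supp// mul0r.
Qed.

Lemma radial_formD b p p' q :
  radial_form b (p + p') q = radial_form b p q + radial_form b p' q.
Proof.
rewrite -RintegralD//; apply: eq_Rintegral => z _.
by rewrite peulerD mulrDl mulrDr.
Qed.

Lemma radial_formZ b a p q : radial_form b (a *: p) q = a * radial_form b p q.
Proof.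
rewrite -RintegralZl//; apply: eq_Rintegral => z _.
by rewrite peulerZ; ring.
Qed.

Lemma radial_formC b p q : radial_form b p q = radial_form b q p.
Proof. by apply: eq_Rintegral => z _; rewrite [peuler u p z * _]mulrC. Qed.

(** As [E] is a derivation, the left side integrates [E] of the product [p(E) u q(E) u], to which
    [integral_euler] applies. *)
Lemma radial_formX b p q :
  radial_form b ('X * p) q + radial_form b p ('X * q) =
  - (2 * ((hdim R n - b) / 2)) * radial_form b p q.
Proof.
have eX : euler (fun z => peuler u p z * peuler u q z) =
    fun z => peuler u ('X * p) z * peuler u q z + peuler u p z * peuler u ('X * q) z.
  apply/funext => z; rewrite euler_mul; try exact: differentiable_peuler.
  by rewrite !euler_peuler.
rewrite -RintegralD//.
transitivity (\int[mu]_z (weight b z * euler (fun z => peuler u p z * peuler u q z) z)).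
  by apply: eq_Rintegral => z _; rewrite eX mulrDr.
rewrite (integral_euler cK K0).
- by congr (_ * _); field.
- by move=> z; apply: differentiableM; exact: differentiable_peuler.
- by rewrite eX => z; apply: cvgD; apply: cvgM; exact: continuous_peuler.
- by move=> z nz; rewrite peuler_supp// mul0r.
- by move=> z nz; rewrite eX !peuler_supp// !mul0r addr0.
Qed.

(** Integrability makes the extended-real integral finite, which reduces the theorem to an identity
    between real numbers. *)
Lemma intG_radial_form b p (F : space -> R) :
  (forall z, F z = weight b z * (peuler u p z * peuler u p z)) ->
  intG F = (radial_form b p p)%:E.
Proof.
move=> hF; rewrite /radial_form /Rintegral fineK; last first.
  exact: (integrable_fin_num measurableT (integrable_form b p p)).
by apply: eq_integral => z _; rewrite hF.
Qed.

Lemma weight_x0 b z : z.1 = 0 -> weight b z = 0.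
Proof.
by move=> z1; rewrite /weight (_ : sqx z = 0) ?mul0r//; apply/eqP; rewrite sqx_eq0 z1.
Qed.

Lemma enorm_x0 z : z.1 = 0 -> enorm z.1 = 0.
Proof.
by move=> z1; apply/eqP; rewrite -sqrf_eq0 enorm_sqx sqx_eq0 z1.
Qed.

Lemma weight_ratio b beta (k : nat) z : z != 0 -> b = beta + 2 * k%:R ->
  weight b z = angular z ^+ 2 / (rho z `^ beta * rho z ^+ (2 * k)).
Proof.
move=> z0 ->; rewrite weightE psiE -/(angular z); congr (_ / _).
have r0 : rho z != 0 by rewrite gt_eqF ?rho_gt0.
by rewrite powRD ?r0 ?implybT// -natrM powR_mulrn ?rho_ge0.
Qed.

(** Off [x = 0], dividing by [grad_rho ^+ (2 * c)] leaves [angular ^+ 2], that is [psi], and the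
    powers of [rho] add up to [b]. On [x = 0] both sides vanish, so the integrands agree everywhere,
    conventional values included. *)
Lemma weighted_square (f : space -> R) p (k c : nat) b beta z :
  (z.1 = 0 -> f z = 0) ->
  (z.1 != 0 -> `|f z| = `|angular z ^+ c.+1 / rho z ^+ k * peuler u p z|) ->
  b = beta + 2 * k%:R ->
  `|f z| ^+ 2 / (grad_rho z ^+ (2 * c) * rho z `^ beta) =
  weight b z * (peuler u p z * peuler u p z).
Proof.
move=> f0 f1 hb; have [z1|z1] := eqVneq z.1 0.
  by rewrite f0// weight_x0// normr0 expr0n/= !mul0r.
have z0 : z != 0 by apply: contra z1 => /eqP ->.
have r0 : rho z != 0 by rewrite gt_eqF ?rho_gt0.
have e0 : angular z != 0.
  by rewrite mulf_neq0 ?invr_eq0// -sqrf_eq0 enorm_sqx sqx_eq0.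
rewrite (weight_ratio z0 hb) grad_rhoE// -/(angular z) f1// real_normK ?num_real//.
rewrite [angular z ^+ c.+1]exprS (mulnC 2 c) (mulnC 2 k) !(exprM _ _ 2).
field.
have rb : rho z `^ beta != 0 by rewrite gt_eqF// powR_gt0// rho_gt0.
by rewrite rb !expf_neq0.
Qed.

Lemma L_radial_x0 f z : z.1 = 0 -> L_radial f z = 0.
Proof. by move=> z1; rewrite /L_radial psiE enorm_x0// mul0r expr0n/= mul0r. Qed.

Lemma T_op_x0 beta f z : z.1 = 0 -> T_op beta f z = 0.
Proof.
move=> z1; have [->|z0] := eqVneq z 0.
  by rewrite /T_op drhoE rho0 mulr0 invr0 mulr0 !mul0r addr0 mulr0.
by rewrite /T_op grad_rhoE// enorm_x0// !mul0r.
Qed.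

Lemma R_op_x0 beta k f z : z.1 = 0 -> R_op beta k f z = 0.
Proof. by case: k => [|k] z1; exact: T_op_x0. Qed.

End test_function_form.

Unset Implicit Arguments.

Theorem theorem1p4 (R : realType) (n k : nat) (beta : R) (u : 'rV[R]_n * R -> R)
    (hn : (1 <= n)%N) (hk : (1 <= k)%N) (hu : test_function u) :
  let Q : R := hdim R n in
  (forall l : nat, (1 <= l)%N -> k = (2 * l)%N ->
    intG (fun z => (`|iter l L_radial u z| ^+ 2
                   / (grad_rho z ^+ (2 * (2 * l - 1)) * rho z `^ beta))%R) =
    ((Cst k Q beta)%:E *
       intG (fun z => (`|u z| ^+ 2 * grad_rho z ^+ 2
                      / rho z `^ (beta + 4 * l%:R))%R)
     + \sum_(0 <= j < 2 * l)
         (Dcst Q j%:Z l beta)%:E *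
         intG (fun z => (`|R_op (beta + 2 * j%:R) (2 * l - 1 - j) u z| ^+ 2
                        / (grad_rho z ^+ (2 * (2 * l - 1 - j))
                           * rho z `^ (beta + 2 * j%:R)))%R))%E) /\
  (forall l : nat, k = (2 * l + 1)%N ->
    intG (fun z => (`|norm_grad_radial (iter l L_radial u) z| ^+ 2
                   / (grad_rho z ^+ (4 * l) * rho z `^ beta))%R) =
    ((Cst k Q beta)%:E *
       intG (fun z => (`|u z| ^+ 2 * grad_rho z ^+ 2
                      / rho z `^ (2 * (2 * l%:R + 1) + beta))%R)
     + \sum_(0 <= j < 2 * l + 1)
         (Dtilde Q j%:Z l beta)%:E *
         intG (fun z => (`|R_op (beta + 2 * j%:R) (2 * l - j) u z| ^+ 2
                        / (grad_rho z ^+ (2 * (2 * l - j))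
                           * rho z `^ (beta + 2 * j%:R)))%R))%E).
Proof.
move=> Q; have [su _ u0] := hu.
(* This integral is the term [S^0] of the expansion, the one carrying the constant [Cst]. *)
have intG_u b : intG (fun z => (`|u z| ^+ 2 * grad_rho z ^+ 2 / rho z `^ b)%R) =
    (radial_form u b 1 1)%:E.
  apply: intG_radial_form => // z; rewrite peuler1 -expr2.
  have [->|z0] := eqVneq z 0.
    have -> : u 0 = 0.
      by apply/eqP; apply: contra_notT u0 => uz; exact: subset_closure.
    by rewrite normr0 expr0n/= !mul0r mulr0.
  by rewrite grad_rhoE// real_normK ?num_real// weightE psiE; ring.
have intG_R b beta' (m : nat) : b = beta' + 2 * m.+1%:R ->
    intG (fun z => (`|R_op beta' m u z| ^+ 2 /
      (grad_rho z ^+ (2 * m) * rho z `^ beta'))%R) =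
    (radial_form u b (('X + ((Q - b) / 2)%:P) ^+ m.+1)
                     (('X + ((Q - b) / 2)%:P) ^+ m.+1))%:E.
  move=> hb; apply: intG_radial_form => // z.
  apply: (weighted_square (k := m.+1)) => //; first exact: R_op_x0.
  move=> z1; rewrite R_opE//; congr (`|_ * peuler u (('X + _%:P) ^+ _) z|).
  by rewrite hb -/Q; field.
split=> l.
- move=> l0 ->.
  (* The exponent common to all terms: the remainder of index [j] has [beta + 2j] from its weight
     and [2(2l - j)] from the powers of [rho] in [R_op]. *)
  pose b := beta + 4 * l%:R; pose kappa := (Q - b) / 2.
  have hk2 : kappa = (Q - beta - 4 * l%:R) / 2 by rewrite /kappa /b; field.
  rewrite intG_u -/b.
  rewrite (@intG_radial_form _ _ _ hu b (radial_poly Q l)); last first.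
    move=> z; apply: (weighted_square (k := 2 * l)) => [||].
    (* Here [1 <= l] matters: the 0-th iterate is [u], which need not vanish on [x = 0]. *)
    + by case: l l0 {b kappa hk2} => // l _; exact: L_radial_x0.
    + by move=> z1; rewrite iter_L_radialE// (_ : (2 * l - 1).+1 = 2 * l)%N//; lia.
    + by rewrite /b natrM; ring.
  have := form_radial_poly_even (radial_formD hu b) (radial_formZ hu b)
    (radial_formC u b) (radial_formX hu b) 1 hk2.
  rewrite !mulr1 => ->.
  (* The last index [j = 2l] is split off from the expansion; its coefficient is [Cst]. *)
  rewrite big_ord_recr/= subnn expr0 mulr1 Dcst_top addrC EFinD EFinM.
  congr (_ + _)%E; rewrite big_mkord -sumEFin; apply: eq_bigr => j _.
  have hj := ltn_ord j.
  have e : ((2 * l - 1 - j).+1 = 2 * l - j)%N by lia.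
  have hb : b = beta + 2 * j%:R + 2 * (2 * l - 1 - j).+1%:R.
    by rewrite e natrB ?natrM; [rewrite /b; ring|lia].
  by rewrite EFinM mulr1 (intG_R _ _ _ hb) e.
- move=> ->.
  pose b := 2 * (2 * l%:R + 1) + beta; pose kappa := (Q - b) / 2.
  have hk2 : kappa = (Q - beta - 4 * l%:R - 2) / 2 by rewrite /kappa /b; field.
  rewrite intG_u -/b.
  rewrite (@intG_radial_form _ _ _ hu b (('X - (2 * l)%:R%:P) * radial_poly Q l));
    last first.
    move=> z; rewrite (_ : 4 * l = 2 * (2 * l))%N; last by lia.
    apply: (weighted_square (k := (2 * l).+1)) => [||].
    + move=> z1; rewrite /norm_grad_radial sqrt_psi enorm_x0// !mul0r //.
    + move=> z1; rewrite /norm_grad_radial sqrt_psi normrM normr_id -normrM.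
      (* The outer radial derivative supplies the factor [X - 2l] and one more power of [rho]. *)
      rewrite (drho_weight su (p := radial_poly Q l) (a := 2 * l) (b := 2 * l)) //.
        by rewrite [angular z ^+ (2 * l).+1]exprS !mulrA.
      by move=> y; exact: iter_L_radialE.
    + by rewrite /b; ring.
  have := form_radial_poly_odd (radial_formD hu b) (radial_formZ hu b)
    (radial_formC u b) (radial_formX hu b) hk2.
  cbv zeta => ->.
  rewrite big_ord_recr/= addn1 subnn expr0 -addn1 Dtilde_top addrC EFinD EFinM.
  congr (_ + _)%E; rewrite big_mkord -sumEFin; apply: eq_bigr => j _.
  have hj := ltn_ord j.
  have e : ((2 * l - j).+1 = 2 * l + 1 - j)%N by lia.
  have hb : b = beta + 2 * j%:R + 2 * (2 * l - j).+1%:R.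
    by rewrite e natrB ?natrD ?natrM; [rewrite /b; ring|lia].
  by rewrite EFinM (intG_R _ _ _ hb) e.
Qed.
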